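(* Let $\lambda,\mu,\nu,\delta,\rho$ be partitions with nonnegative parts (at most $n$ parts), $M\in\mathrm{HIVE}^\rho_{\lambda\delta}$, $N\in\mathrm{HIVE}^\delta_{\mu\nu}$, and let $P,Q$ be the hives produced from $(M,N)$ by the octahedron recurrence as in the context. Then $$R(\widehat M,\widehat N)=\widehat P\qquad\text{and}\qquad J(\widehat M\star\widehat N)=\widehat Q.$$
   Context: Let $\Delta_n=\{(x,y,z)\in\mathbb Z_{\ge0}^3:x+y+z=n\}$. A function $P:\Delta_n\to\mathbb Z$ satisfies the hive condition if (whenever all points lie in $\Delta_n$) (i) $P(x,y,z)+P(x,y+1,z-1)\ge P(x+1,y,z-1)+P(x-1,y+1,z)$, (ii) $P(x,y,z)+P(x+1,y,z-1)\ge P(x,y+1,z-1)+P(x+1,y-1,z)$, (iii) $P(x,y,z)+P(x+1,y-1,z)\ge P(x+1,y,z-1)+P(x,y-1,z+1)$; a hive is such a function modulo constants. $\mathrm{HIVE}^\nu_{\lambda\mu}$: hives with $\lambda_k=P(n-k,k,0)-P(n-k+1,k-1,0)$, $\mu_k=P(k,0,n-k)-P(k-1,0,n-k+1)$, $\nu_k=P(0,k,n-k)-P(0,k-1,n-k+1)$. Construction of $P,Q$: choose representatives with $M(k,0,n-k)=N(0,k,n-k)$ for all $k$. Let $\mathcal L=\{(x,y,t)\in\mathbb Z^3:0\le x,y\le n,\ x+y+t\text{ even}\}$. Define $f$ on the points with $t=|x-y|$ by $f(x,n-z,y)=M(x,y,z)$ and $f(n-z,y,x)=N(x,y,z)$,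 $(x,y,z)\in\Delta_n$. Extend $f$, inductively in $t$, to all points of $\mathcal L$ in $A=\{|x-y|\le t\le n-|n-x-y|\}$ by $f(x,y,t+1)=\max(f(x+1,y,t)+f(x-1,y,t),f(x,y+1,t)+f(x,y-1,t))-f(x,y,t-1)$. Set $P(x,y,z)=f(n-y,n-z,n-x)$ and $Q(x,y,z)=f(x,y,n-z)$. For any $P:\Delta_n\to\mathbb Z$, $\widehat P(i,j)=P(i-j,j,n-i)-P(i-j+1,j-1,n-i)$, $1\le j\le i\le n$; for hives this is a Gelfand–Tsetlin pattern, identified with the tableau $T$ (entries in $\{1..n\}$, rows weakly and columns strictly increasing) with $T(i,j)=\#\{\text{entries}\le i\text{ in row }j\}$; $\widehat M$ has shape $\lambda$ and $\widehat N$ has shape $\mu$. For tableaux $T$ (shape $\lambda$), $U$ (shape $\mu$): $T\star U$ is the skew tableau with $U$ up and to the right of $T$ (rows $r\le n$: row $r$ of $U$ in columns $\lambda_1+1..\lambda_1+\mu_r$; rows $n+r$: row $r$ of $T$ in columns $1..\lambda_r$); $J(X)$ is jeu de taquin rectification. $J^n=T$, $J^{k-1}=((J^k\leftarrow a_1)\leftarrow\cdots)\leftarrow a_l$ with $a_1\le\dots\le a_l$ the entries of row $k$ of $U$ ($\leftarrow$ = row insertion); $\lambda^k$ = shape of $J^k$; $R(T,U)(i,j)=\sum_{r\ge j}\lambda^{i-j+1}_r-\sum_{r\ge j+1}\lambda^{i-j}_r$. *)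

(* Defs.v *)
From mathcomp Require Import all_boot all_order all_algebra.
From mathcomp Require Import zify.

Set Implicit Arguments.
Unset Strict Implicit.
Unset Printing Implicit Defensive.

Import Order.TTheory GRing.Theory Num.Theory.
Local Open Scope ring_scope.

(* A function on Delta_n = {(x,y,z) : x + y + z = n} is a total function of    *)
(* three natural numbers whose values off Delta_n are never used.  The guards  *)
(* in the hive condition say exactly that the four points lie in Delta_n, so   *)
(* no truncated predecessor is ever met.                                       *)
Definition hive_condition (n : nat) (P : nat -> nat -> nat -> int) : Prop :=
  forall x y z : nat, (x + y + z)%N = n ->
  [/\ (0 < x)%N -> (0 < z)%N ->
        P x.+1 y z.-1 + P x.-1 y.+1 z <= P x y z + P x y.+1 z.-1,
      (0 < y)%N -> (0 < z)%N ->
        P x y.+1 z.-1 + P x.+1 y.-1 z <= P x y z + P x.+1 y z.-1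
    & (0 < y)%N -> (0 < z)%N ->
        P x.+1 y z.-1 + P x y.-1 z.+1 <= P x y z + P x.+1 y.-1 z].

(* The partition (l_1, ..., l_n) is an n-tuple, padded with zeros.             *)
Definition is_partition (n : nat) (l : n.-tuple nat) : Prop := sorted geq l.

Definition part (n : nat) (l : n.-tuple nat) (k : nat) : int :=
  (nth 0%N l k.-1)%:Z.

(* HIVE n lambda mu nu M: M represents (modulo constants) an element of        *)
(* HIVE^nu_{lambda mu}.                                                        *)
Definition HIVE (n : nat) (lambda mu nu : n.-tuple nat)
    (M : nat -> nat -> nat -> int) : Prop :=
  hive_condition n M /\
  forall k : nat, (1 <= k <= n)%N ->
  [/\ part lambda k = M (n - k)%N k 0%N - M (n - k + 1)%N k.-1 0%N,
      part mu k = M k 0%N (n - k)%N - M k.-1 0%N (n - k + 1)%N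
    & part nu k = M 0%N k (n - k)%N - M 0%N k.-1 (n - k + 1)%N].

(* Representatives agreeing along the common edge of the two hives.            *)
Definition matching (n : nat) (M N : nat -> nat -> nat -> int) : Prop :=
  forall k : nat, (k <= n)%N -> M k 0%N (n - k)%N = N 0%N k (n - k)%N.

(* octahedron n M N t x y is f(x,y,t).  The first two branches are the initial *)
(* values f(x,n-z,y) = M(x,y,z) and f(n-z,y,x) = N(x,y,z) on t = |x - y|; they *)
(* agree for t = 0 when M and N match.  Values outside the region              *)
(* |x-y| <= t <= n - |n-x-y|, x + y + t even, are irrelevant: the recurrence   *)
(* inside the region never refers to them (in particular x, y > 0 there).      *)
Fixpoint octahedron (n : nat) (M N : nat -> nat -> nat -> int)
    (t x y : nat) {struct t} : int :=
  if y == (x + t)%N then M x t (n - y)%N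
  else if x == (y + t)%N then N t y (n - x)%N
  else if t is t1.+1 then
    if t1 is t2.+1 then
      Num.max (octahedron n M N t1 x.+1 y + octahedron n M N t1 x.-1 y)
              (octahedron n M N t1 x y.+1 + octahedron n M N t1 x y.-1)
      - octahedron n M N t2 x y
    else 0
  else 0.

Definition octa_P (n : nat) (M N : nat -> nat -> nat -> int)
    (x y z : nat) : int := octahedron n M N (n - x)%N (n - y)%N (n - z)%N.

Definition octa_Q (n : nat) (M N : nat -> nat -> nat -> int)
    (x y z : nat) : int := octahedron n M N (n - z)%N x y.

Definition hat (n : nat) (P : nat -> nat -> nat -> int) (i j : nat) : int :=
  P (i - j)%N j (n - i)%N - P (i - j + 1)%N j.-1 (n - i)%N.

(* Equality of triangular arrays indexed by 1 <= j <= i <= n.                  *)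
Definition eq_pattern (n : nat) (g h : nat -> nat -> int) : Prop :=
  forall i j : nat, (1 <= j <= i)%N -> (i <= n)%N -> g i j = h i j.

(* A semistandard tableau with entries in {1..n} is the list of its n rows,    *)
(* the last ones possibly empty.                                               *)
Definition is_tableau (n : nat) (T : seq (seq nat)) : Prop :=
  [/\ size T = n,
      forall s, s \in T -> sorted leq s /\ {in s, forall a, (1 <= a <= n)%N}
    & forall r c : nat, (c < size (nth [::] T r.+1))%N ->
        (c < size (nth [::] T r))%N /\
        (nth 0%N (nth [::] T r) c < nth 0%N (nth [::] T r.+1) c)%N].

(* T(i,j), the number of entries <= i in row j of T.                           *)
Definition pattern (T : seq (seq nat)) (i j : nat) : int :=
  (count (fun a => (a <= i)%N) (nth [::] T j.-1))%:Z.

(* T is the tableau identified with the Gelfand-Tsetlin pattern g.             *)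
Definition tableau_of (n : nat) (g : nat -> nat -> int) (T : seq (seq nat))
  : Prop := is_tableau n T /\ eq_pattern n (pattern T) g.

Fixpoint row_insert (T : seq (seq nat)) (a : nat) : seq (seq nat) :=
  if T is s :: T' then
    let k := find (fun b => (a < b)%N) s in
    if (k < size s)%N then set_nth 0%N s k a :: row_insert T' (nth 0%N s k)
    else rcons s a :: T'
  else [:: [:: a]].

(* J^k for 0 <= k <= n: rows n, n-1, ..., k+1 of U are inserted into T in this *)
(* order, each of them from left to right.                                     *)
Definition insertion_stage (T U : seq (seq nat)) (k : nat) : seq (seq nat) :=
  foldl (fun J s => foldl row_insert J s) T (rev (drop k U)).

(* sumn (drop k (shape J)) is the sum of the lengths of the rows of index      *)
(* r >= k + 1 of J, rows being counted from 1.                                 *)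
Definition recording (T U : seq (seq nat)) (i j : nat) : int :=
  (sumn (drop j.-1 (shape (insertion_stage T U (i - j + 1)%N))))%:Z
  - (sumn (drop j (shape (insertion_stage T U (i - j)%N))))%:Z.

(* Partial fillings of the quadrant, by row and column, both counted from 0.   *)
Definition filling := nat -> nat -> option nat.

Definition fill (T : seq (seq nat)) : filling :=
  fun r c => onth (nth [::] T r) c.

Definition put (F : filling) (r c : nat) (v : option nat) : filling :=
  fun r' c' => if (r' == r) && (c' == c) then v else F r' c'.

(* slide F r c G: starting from the filling F with a hole at (r,c), the jeu de *)
(* taquin slide ends with the filling G.  The smaller of the entries to the    *)
(* right of the hole and below it moves in; for equal entries it is the one    *)
(* below.                                                                      *)
Inductive slide (F : filling) (r c : nat) (G : filling) : Prop :=
| Slide_stop of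
    F r c.+1 = None & F r.+1 c = None
    & G = put F r c None
| Slide_right a of
    F r c.+1 = Some a
    & (forall b, F r.+1 c = Some b -> (a < b)%N)
    & slide (put F r c (Some a)) r c.+1 G
| Slide_down b of
    F r.+1 c = Some b
    & (forall a, F r c.+1 = Some a -> (b <= a)%N)
    & slide (put F r c (Some b)) r.+1 c G.

(* A skew tableau consists of its inner shape and its filling.                 *)
Record skew_tableau := SkewTableau {
  inner : nat -> nat;
  entries : filling
}.

(* Slide into an arbitrary corner of the inner shape, until the inner shape is *)
(* empty.                                                                      *)
Inductive rectifies (X : skew_tableau) (H : filling) : Prop :=
| Rect_straight of (forall r, inner X r = 0%N) & H = entries X
| Rect_slide r G of
    (inner X r.+1 < inner X r)%N
    & slide (entries X) r (inner X r).-1 G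
    & rectifies (SkewTableau (fun k => (inner X k - (k == r))%N) G) H.

(* J(X) = V: the rectification of X exists, does not depend on the chosen      *)
(* slides, and is V.                                                           *)
Definition rectification_is (X : skew_tableau) (V : seq (seq nat)) : Prop :=
  (exists H, rectifies X H) /\ (forall H, rectifies X H -> H =2 fill V).

(* T * U for T and U with n rows each (some possibly empty).                   *)
Definition star (n : nat) (T U : seq (seq nat)) : skew_tableau :=
  let l1 := size (nth [::] T 0) in
  SkewTableau
    (fun r => if (r < n)%N then l1 else 0%N)
    (fun r c => if (r < n)%N then
                  if (c < l1)%N then None else fill U r (c - l1)%N
                else fill T (r - n)%N c).

(* Neither the tableaux of two hives nor matching representatives are extra    *)
(* data: every hive has a tableau, and a constant added to N makes it match M. *)

Definition pattern_entry (n : nat) (h : nat -> nat -> nat) (j c : nat) : nat :=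
  find (fun i => (c < h i j)%N) (iota 0 n.+1).

Definition pattern_rows (n : nat) (h : nat -> nat -> nat) : seq (seq nat) :=
  mkseq (fun r => mkseq (pattern_entry n h r.+1) (h n r.+1)) n.

Lemma pattern_mono (n : nat) (h : nat -> nat -> nat)
    (hm : forall i j, (i < n)%N -> (h i j <= h i.+1 j)%N)
    (j i k : nat) :
  (i <= k)%N -> (k <= n)%N -> (h i j <= h k j)%N.
Proof.
elim: k => [|k IH] ik kn; first by have -> : i = 0%N by lia.
move: ik; rewrite leq_eqVlt => /orP[/eqP -> //|ik].
by apply: leq_trans (hm _ _ _); [apply: IH; lia | lia].
Qed.

Lemma pattern_entryP (n : nat) (h : nat -> nat -> nat)
    (hm : forall i j, (i < n)%N -> (h i j <= h i.+1 j)%N)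
    (j c i : nat) :
  (i <= n)%N -> (pattern_entry n h j c <= i)%N = (c < h i j)%N.
Proof.
move=> ni; apply/idP/idP => H.
  have hs : has (fun i => (c < h i j)%N) (iota 0 n.+1).
    rewrite has_find size_iota; move: H; rewrite /pattern_entry; lia.
  have := nth_find 0%N hs; rewrite nth_iota; last by move: hs; rewrite has_find size_iota.
  rewrite add0n => /leq_trans; apply; exact: (pattern_mono hm).
rewrite leqNgt; apply/negP => H1.
have := before_find 0%N H1; rewrite nth_iota; last by lia.
by rewrite add0n H.
Qed.

Lemma nth_pattern_rows (n : nat) (h : nat -> nat -> nat) (r : nat) :
  nth [::] (pattern_rows n h) r =
  if (r < n)%N then mkseq (pattern_entry n h r.+1) (h n r.+1) else [::].
Proof.
case: ltnP => rn; first by rewrite nth_mkseq.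
by rewrite nth_default // size_mkseq.
Qed.

Lemma pattern_rowsP (n : nat) (h : nat -> nat -> nat)
    (h0 : forall j, h 0%N j = 0%N)
    (hm : forall i j, (i < n)%N -> (h i j <= h i.+1 j)%N)
    (hd : forall i j, (0 < j)%N -> (i < n)%N -> (h i.+1 j.+1 <= h i j)%N) :
  is_tableau n (pattern_rows n h) /\
  forall i j, (0 < j <= n)%N -> (i <= n)%N ->
    pattern (pattern_rows n h) i j = (h i j)%:Z.
Proof.
pose e := pattern_entry n h; pose T := pattern_rows n h.
have eP := pattern_entryP hm; rewrite -/e in eP.
split; last first.
  move=> i j /andP[j0 jn] ni; rewrite /pattern nth_pattern_rows -/e prednK // jn; congr Posz.
  rewrite /mkseq count_map (@eq_count _ _ (fun c => c < h i j)%N); last by move=> c /=; rewrite eP.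
  have H : (h i j <= h n j)%N by exact: (pattern_mono hm).
  rewrite -(subnKC H) iotaD count_cat.
  rewrite (eq_in_count (a2 := predT)); last by move=> c; rewrite mem_iota /= add0n.
  rewrite (eq_in_count (a1 := fun c => (c < h i j)%N) (a2 := pred0)); last first.
    by move=> c; rewrite mem_iota /=; lia.
  by rewrite count_predT size_iota count_pred0 addn0.
split; first by rewrite size_mkseq.
  move=> s /mapP[r]; rewrite mem_iota => rn ->; split.
    apply: (@homo_sorted _ _ (e r.+1) leq leq); last exact: iota_sorted.
    move=> c d cd. have [dn|] := leqP (e r.+1 d) n; first by rewrite eP //; apply: leq_ltn_trans cd _; rewrite -eP.
    move=> H; apply: leq_trans H.
    by apply: leq_trans (find_size _ _) _; rewrite size_iota.
  move=> a /mapP[c]; rewrite mem_iota add0n => cn ->; apply/andP; split; last by rewrite eP.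
  by rewrite ltnNge eP // h0.
move=> r c; rewrite !nth_pattern_rows -/e; case: (ltnP r.+1 n) => // rn; rewrite (ltnW rn) !size_mkseq => H.
have n0 : (n.-1.+1 = n)%N by lia.
have H2 : (c < h n r.+1)%N.
  have := @hd n.-1 r.+1; rewrite n0 => /(_ isT _) H1.
  have := @hm n.-1 r.+1; rewrite n0; lia.
split=> //; rewrite !nth_mkseq //.
have en : (e r.+2 c <= n)%N by rewrite eP.
have ep : (0 < e r.+2 c)%N by rewrite ltnNge eP // h0.
have := leqnn (e r.+2 c); rewrite eP // => Hc.
have := @hd (e r.+2 c).-1 r.+1 isT; rewrite prednK // => /(_ en) H3.
have : (e r.+1 c <= (e r.+2 c).-1)%N by rewrite eP //; lia.
lia.
Qed.

Lemma tableau_of_hive n (l m nu : n.-tuple nat) M :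
  HIVE l m nu M -> exists T, tableau_of n (hat n M) T.
Proof.
move=> [hc hb].
have up i j : (0 < j <= i)%N -> (i < n)%N -> hat n M i j <= hat n M i.+1 j.
  move=> ji ni; have [|+ _ _] := hc (i - j).+1 j.-1 (n - i)%N; first by lia.
  rewrite /hat.
  have -> : ((i.+1 - j) = (i-j).+1)%N by lia.
  have -> : ((n - i.+1) = (n-i).-1)%N by lia.
  rewrite !addn1 /= prednK; last by lia.
  have -> : (0 < n - i)%N by lia.
  move=> /(_ isT isT); lia.
have dn i j : (0 < j <= i)%N -> (i < n)%N -> hat n M i.+1 j.+1 <= hat n M i j.
  move=> ji ni; have [|_ + _] := hc (i - j)%N j (n - i)%N; first by lia.
  rewrite /hat.
  have -> : ((n - i.+1) = (n-i).-1)%N by lia.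
  rewrite !addn1 subSS /=.
  have -> : (0 < n - i)%N by lia.
  have -> : (0 < j)%N by lia.
  move=> /(_ isT isT); lia.
have nn k : forall i j, (0 < j <= i)%N -> (i + k)%N = n -> 0 <= hat n M i j.
  elim: k => [|k IH] i j ji ik.
    have ->: i = n by lia.
    have [|+ _ _] := hb j; first by lia.
    by rewrite /hat subnn => <-.
  by apply: le_trans (dn _ _ _ _); [apply: IH | |]; lia.
pose h i j := if (0 < j <= i)%N then `|hat n M i j|%N else 0%N.
have hE i j : (0 < j <= i)%N -> (i <= n)%N -> (h i j)%:Z = hat n M i j.
  by move=> ji ni; rewrite /h ji gez0_abs // (nn (n - i)%N) //; lia.
have := @pattern_rowsP n h; case.
- by move=> j; rewrite /h; case: ifP => //; lia.
- move=> i j ni; case ji: (0 < j <= i)%N; last by rewrite {1}/h ji.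
  rewrite -lez_nat !hE //; try lia; exact: up.
- move=> i j j0 ni; case ji: (0 < j <= i)%N.
    rewrite -lez_nat !hE //; try lia; exact: dn.
  by rewrite /h ifF //; lia.
move=> A B; eexists; split; first exact: A.
by move=> i j ij ni; rewrite B ?hE //; lia.
Qed.

Lemma matching_shift n (l m nu d r : n.-tuple nat) M N :
  HIVE l d r M -> HIVE m nu d N ->
  exists c : int, matching n M (fun x y z => N x y z + c).
Proof.
move=> [_ hM] [_ hN]; exists (M 0%N 0%N n - N 0%N 0%N n) => k.
elim: k => [_|k IH kn]; first by rewrite !subn0; lia.
have [|_ A _] := hM k.+1; first by lia.
have [|_ _ B] := hN k.+1; first by lia.
have E : (n - k.+1 + 1 = n - k)%N by lia.
move: A B (IH (ltnW kn)); rewrite E /=; lia.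
Qed.

(* Main.v *)
Require Import Defs.
From mathcomp Require Import all_boot all_order all_algebra.
From mathcomp Require Import zify ring.

(* Row insertion of a weakly increasing word is tropical: if c(i) counts the letters <= i
   of a row and w(i) those of the inserted word, the new row satisfies
   c'(i) = max(c'(i-1), c(i)) + w(i) - w(i-1), and the bumped word is w + c - c'.
   Summing over the first j rows of J^k and the first k rows of U turns this into the
   octahedron recurrence for G^k(i,j) = #{letters <= i in rows 1..j of J^k}
   + #{letters <= i in rows 1..k of U}, with f(i-j, j+k, i-k) = G^k(i,j) + N(i,0,n-i).
   The faces t = |x-y| match because row k of U cannot affect letters <= i in row j when
   j + k > i.  Reading f on k = 0 and on i = n gives the tableau J^0 and the recording
   pattern.  Jeu de taquin slides preserve the Knuth class of the reading word, Knuth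
   equivalent words insert alike, and a straight tableau is recovered by inserting its
   own reading word; hence every rectification of T * U is J^0. *)

Set Implicit Arguments.
Unset Strict Implicit.
Unset Printing Implicit Defensive.

(** * Row insertion on counting functions, and Knuth relations *)

Definition cum (s : seq nat) (i : nat) : nat := count (fun a => a <= i) s.

Definition mono (c : nat -> nat) : Prop := forall i k, i <= k -> c i <= c k.

Definition eq_upto (n : nat) (c c' : nat -> nat) : Prop :=
  forall i, i <= n -> c i = c' i.

Definition ins (c : nat -> nat) (x : nat) : nat -> nat :=
  fun i => if x <= i then maxn (c x).+1 (c i) else c i.

(* A letter that bumps nothing sends n.+1 to the next row; letters above n are inert. *)
Definition bumped (n : nat) (c : nat -> nat) (x : nat) : nat :=
  if x <= n then find (fun i => c x < c i) (iota 0 n.+1) else x.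

Definition row_result (c : nat -> nat) (w : seq nat) : nat -> nat := foldl ins c w.

Fixpoint row_output (n : nat) (c : nat -> nat) (w : seq nat) : seq nat :=
  if w is x :: w' then bumped n c x :: row_output n (ins c x) w' else [::].

Fixpoint arriving (n : nat) (J : nat -> nat -> nat) (w : seq nat) (j : nat) : seq nat :=
  if j is j'.+1 then row_output n (J j') (arriving n J w j') else w.

Definition act (n : nat) (J : nat -> nat -> nat) (w : seq nat) : nat -> nat -> nat :=
  fun j => row_result (J j) (arriving n J w j).

Arguments cum : simpl never.

Lemma cum_mono s : mono (cum s).
Proof. by move=> i k ik; apply: sub_count => a /= /leq_trans; apply. Qed.

Lemma cum_cons a s i : cum (a :: s) i = (a <= i) + cum s i.
Proof. by []. Qed.

Lemma cum_eq0 s i : all (fun a => i < a) s -> cum s i = 0.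
Proof.
move=> si; apply/eqP; rewrite -leqn0 leqNgt -has_count; apply/hasP => -[a aw].
by have := allP si _ aw; lia.
Qed.

Lemma ins_mono c x : mono c -> mono (ins c x).
Proof.
move=> cm i k ik; rewrite /ins; have := cm _ _ ik.
by case: (leqP x i); case: (leqP x k) => ? ? ; have := cm x k; lia.
Qed.

Lemma ins_ge c x i : c i <= ins c x i.
Proof. by rewrite /ins; case: ifP => _; lia. Qed.

Lemma eq_upto_ins n c c' x : eq_upto n c c' -> eq_upto n (ins c x) (ins c' x).
Proof.
move=> cc i ni; rewrite /ins; case: leqP => xi; rewrite (cc _ ni) //.
by rewrite cc //; apply: leq_trans xi ni.
Qed.

Lemma bumped_eq n c c' x x' : x <= n -> x' <= n ->
  (forall i, i <= n -> (c x < c i) = (c' x' < c' i)) -> bumped n c x = bumped n c' x'.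
Proof.
move=> xn xn' H; rewrite /bumped xn xn'; apply: eq_in_find => i.
by rewrite mem_iota => ?; apply: H; lia.
Qed.

Lemma eq_upto_bump n c c' x : eq_upto n c c' -> bumped n c x = bumped n c' x.
Proof.
move=> cc; case: (leqP x n) => xn; first by apply: bumped_eq => // i ni; rewrite !cc.
by rewrite /bumped leqNgt xn.
Qed.

Lemma bumped_leE n c x i : mono c -> x <= n -> i <= n -> (bumped n c x <= i) = (c x < c i).
Proof.
move=> cm xn ni; rewrite /bumped xn; apply/idP/idP => H.
  have hs : has (fun i => c x < c i) (iota 0 n.+1).
    by rewrite has_find size_iota; apply: leq_ltn_trans H _.
  have := nth_find 0 hs; rewrite nth_iota; last by rewrite has_find size_iota in hs.
  by rewrite add0n => /leq_trans; apply; apply: cm.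
rewrite leqNgt; apply/negP => H1.
by have := before_find 0 H1; rewrite nth_iota ?add0n ?H // ltnS.
Qed.

Lemma bumped_ltn n c x : mono c -> x <= n -> x < bumped n c x.
Proof. by move=> cm xn; rewrite ltnNge bumped_leE // ltnn. Qed.

Lemma bumped_le n c x : x <= n -> bumped n c x <= n.+1.
Proof. by move=> xn; rewrite /bumped xn; apply: leq_trans (find_size _ _) _; rewrite size_iota. Qed.

Lemma bumped_inert n c x : n < x -> bumped n c x = x.
Proof. by rewrite /bumped ltnNge => /negbTE ->. Qed.

Lemma bumped_homo n c x y : mono c -> x <= y -> bumped n c x <= bumped n (ins c x) y.
Proof.
move=> cm xy; case: (leqP y n) => yn; last first.
  rewrite (bumped_inert _ yn); case: (leqP x n) => xn; last by rewrite bumped_inert.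
  exact: leq_trans (bumped_le _ xn) yn.
have xn := leq_trans xy yn; have := @bumped_leE n (ins c x) y (bumped n (ins c x) y).
case: (leqP (bumped n (ins c x) y) n) => bn; last by have := bumped_le c xn; lia.
move/(_ (ins_mono x cm) yn isT); rewrite leqnn => /esym.
rewrite bumped_leE // /ins xy; case: ifP => _; have := cm _ _ xy; lia.
Qed.

Lemma ins_bumped n c x i : mono c -> i <= n ->
  ins c x i + (bumped n c x <= i) = c i + (x <= i).
Proof.
move=> cm ni; case: (leqP x n) => xn.
  rewrite bumped_leE // /ins; case: (leqP x i) => xi; have := cm x i; have := cm i x; lia.
by rewrite bumped_inert // /ins; have -> : (x <= i) = false by lia.
Qed.

Lemma row_result_mono c w : mono c -> mono (row_result c w).
Proof. by elim: w c => //= x w IH c cm; apply: IH; apply: ins_mono. Qed.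

Lemma row_result_ge c w i : c i <= row_result c w i.
Proof. by elim: w c => //= x w IH c; apply: leq_trans (IH _); apply: ins_ge. Qed.

Lemma row_result_lt c w i : all (fun a => i < a) w -> row_result c w i = c i.
Proof.
elim: w c => //= x w IH c /andP[ix iw]; rewrite IH // /ins.
by rewrite leqNgt ix.
Qed.

Lemma row_conservation n c w i : mono c -> i <= n ->
  cum (row_output n c w) i + row_result c w i = cum w i + c i.
Proof.
move=> cm ni; elim: w c cm => //= x w IH c cm.
rewrite !cum_cons -addnA IH; last exact: ins_mono.
have := ins_bumped x cm ni; lia.
Qed.

Lemma path_row_output n c x w : mono c -> path leq x w ->
  path leq (bumped n c x) (row_output n (ins c x) w).
Proof.
elim: w x c => //= y w IH x c cm /andP[xy yw].
by rewrite bumped_homo //= IH //; apply: ins_mono.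
Qed.

Lemma sorted_row_output n c w : mono c -> sorted leq w -> sorted leq (row_output n c w).
Proof. by case: w => //= x w cm; apply: path_row_output. Qed.

Lemma row_result_rec c w i : mono c -> sorted leq w -> 0 < i ->
  row_result c w i + cum w i.-1 = maxn (row_result c w i.-1) (c i) + cum w i.
Proof.
move=> cm + i0; elim: w c cm => [|x w IH] c cm.
  by move=> _; rewrite /cum /=; have := cm i.-1 i; lia.
move=> /= xw; have := IH (ins c x) (ins_mono x cm) (path_sorted xw).
move: xw; rewrite (path_sortedE leq_trans) => /andP[xw _].
rewrite !cum_cons -/(row_result _ _) /=.
have le k : k < x -> cum w k = 0.
  by move=> kx; apply: cum_eq0; apply: sub_all xw => a; apply: leq_trans.
have insl k : x <= k -> ins c x k = maxn (c x).+1 (c k) by rewrite /ins => ->.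
have inss k : k < x -> ins c x k = c k by move=> kx; rewrite /ins leqNgt kx.
case: (ltngtP x i) => [xi|ix|xi].
- have := row_result_ge (ins c x) w i.-1; rewrite !insl; lia.
- rewrite (inss _ ix); lia.
subst i; rewrite [row_result _ _ _.-1]row_result_lt; last first.
  by apply: sub_all xw => a /=; lia.
rewrite inss ?insl //; last by lia.
have := cm x.-1 x; have := le x.-1; lia.
Qed.

Lemma row_output_cat n c u v :
  row_output n c (u ++ v) = row_output n c u ++ row_output n (row_result c u) v.
Proof. by elim: u c => //= x u IH c; rewrite IH. Qed.

Lemma arriving_cat n J u v j :
  arriving n J (u ++ v) j = arriving n J u j ++ arriving n (act n J u) v j.
Proof. by elim: j => //= j ->; rewrite row_output_cat. Qed.

Lemma act_cat n J u v j : act n J (u ++ v) j = act n (act n J u) v j.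
Proof. by rewrite {1}/act arriving_cat /row_result foldl_cat. Qed.

Lemma act_mono n J w j : mono (J j) -> mono (act n J w j).
Proof. exact: row_result_mono. Qed.

Lemma sorted_arriving n J w j : (forall j, mono (J j)) -> sorted leq w ->
  sorted leq (arriving n J w j).
Proof. by move=> Jm ws; elim: j => //= j IH; apply: sorted_row_output. Qed.

Lemma eq_upto_row n c c' w : eq_upto n c c' ->
  eq_upto n (row_result c w) (row_result c' w) /\ row_output n c w = row_output n c' w.
Proof.
elim: w c c' => //= x w IH c c' cc.
have [A ->] := IH _ _ (eq_upto_ins x cc).
by rewrite (eq_upto_bump x cc).
Qed.

Lemma eq_upto_act n J J' w : (forall j, eq_upto n (J j) (J' j)) ->
  forall j, eq_upto n (act n J w j) (act n J' w j).
Proof.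
move=> JJ; have E j : arriving n J w j = arriving n J' w j.
  by elim: j => //= j ->; case: (eq_upto_row (arriving n J' w j) (JJ j)).
by move=> j; rewrite /act E; case: (eq_upto_row (arriving n J' w j) (JJ j)).
Qed.

Inductive knuth (n : nat) : seq nat -> seq nat -> Prop :=
| Knuth_inert a z of n < z : knuth n [:: a; z] [:: z; a]
| Knuth_left x y z of x < y & y <= z : knuth n [:: y; z; x] [:: y; x; z]
| Knuth_right x y z of x <= y & y < z : knuth n [:: x; z; y] [:: z; x; y]
| Knuth_refl w : knuth n w w
| Knuth_sym u v of knuth n u v : knuth n v u
| Knuth_trans u v w of knuth n u v & knuth n v w : knuth n u w
| Knuth_cat u u' v v' of knuth n u u' & knuth n v v' : knuth n (u ++ v) (u' ++ v').

Lemma knuth_row_inert n c a z : mono c -> n < z ->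
  eq_upto n (row_result c [:: a; z]) (row_result c [:: z; a]) /\
  knuth n (row_output n c [:: a; z]) (row_output n c [:: z; a]).
Proof.
move=> cm nz.
have E c' : eq_upto n (ins c' z) c' by move=> i ni; rewrite /ins leqNgt (leq_ltn_trans ni nz).
split=> /=.
  by move=> i ni; rewrite E // (eq_upto_ins a (E c)).
by rewrite (eq_upto_bump a (E c)) !(bumped_inert _ nz); apply: Knuth_inert.
Qed.

Lemma knuth_row_left n c x y z : mono c -> x < y -> y <= z -> z <= n ->
  eq_upto n (row_result c [:: y; z; x]) (row_result c [:: y; x; z]) /\
  knuth n (row_output n c [:: y; z; x]) (row_output n c [:: y; x; z]).
Proof.
move=> cm xy yz zn; have cm1 := ins_mono y cm.
have [xn yn] : x <= n /\ y <= n by lia.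
have cxy := cm _ _ (ltnW xy); have cyz := cm _ _ yz.
split=> /=.
  move=> i ni; rewrite /ins; have := cm i y; have := cm i z; have := cm y i; have := cm z i.
  by do ![case: ifP => ?]; lia.
have -> : bumped n (ins (ins c y) x) z = bumped n (ins c y) z.
  apply: bumped_eq => // i ni; rewrite /ins; have := cm i z; have := cm z i; have := cm y i.
  have := cm i x.
  by do ![case: ifP => ?]; lia.
have -> : bumped n (ins (ins c y) z) x = bumped n (ins c y) x.
  apply: bumped_eq => // i ni; rewrite /ins; have := cm i z; have := cm z i; have := cm y i.
  by do ![case: ifP => ?]; lia.
case: (leqP (bumped n (ins c y) z) n) => zn'; last first.
  by apply: (@Knuth_cat _ [:: _] [:: _] [:: _; _]); [apply: Knuth_refl|apply/Knuth_sym/Knuth_inert].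
apply: Knuth_left; last exact: bumped_homo.
apply: leq_ltn_trans (bumped_ltn cm yn).
by rewrite bumped_leE // /ins; do ![case: ifP => ?]; lia.
Qed.

Lemma knuth_row_right n c x y z : mono c -> x <= y -> y < z -> z <= n ->
  eq_upto n (row_result c [:: x; z; y]) (row_result c [:: z; x; y]) /\
  knuth n (row_output n c [:: x; z; y]) (row_output n c [:: z; x; y]).
Proof.
move=> cm xy yz zn.
have [xn yn] : x <= n /\ y <= n by lia.
have cxy := cm _ _ xy; have cyz := cm _ _ (ltnW yz).
split=> /=.
  move=> i ni; rewrite /ins.
  have := cm i y; have := cm i z; have := cm i x.
  have := cm x i; have := cm y i; have := cm z i.
  by do ![case: ifP => ?]; lia.
have cm1 := ins_mono x cm; have cm2 := ins_mono z cm1.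
case: (leqP (bumped n c x) z) => xz.
  have := xz; rewrite bumped_leE // => cxz.
  have -> : bumped n (ins c x) z = bumped n c z.
    apply: bumped_eq => // i ni; rewrite /ins; have := cm i z; have := cm z i.
    by have := cm i x; do ![case: ifP => ?]; lia.
  have -> : bumped n (ins c z) x = bumped n c x.
    apply: bumped_eq => // i ni; rewrite /ins; have := cm i z; have := cm z i.
    by do ![case: ifP => ?]; lia.
  have E : bumped n (ins (ins c x) z) y = bumped n (ins (ins c z) x) y.
    apply: bumped_eq => // i ni; rewrite /ins; have := cm i z; have := cm z i.
    have := cm i x; have := cm x i; have := cm y i; have := cm i y.
    by do ![case: ifP => ?]; lia.
  rewrite -E; case: (leqP (bumped n c z) n) => zn'; last first.
    apply: (@Knuth_cat _ [:: _; _] [:: _; _] [:: _]); [exact: Knuth_inert|apply: Knuth_refl].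
  have yz' : bumped n (ins (ins c x) z) y <= z.
    by rewrite bumped_leE // /ins; do ![case: ifP => ?]; lia.
  apply: Knuth_right; last by apply: leq_ltn_trans (bumped_ltn cm zn).
  have : ins (ins c x) z y < ins (ins c x) z (bumped n (ins (ins c x) z) y).
    by rewrite -(@bumped_leE n) //; apply: leq_trans yz' zn.
  rewrite bumped_leE //; last exact: leq_trans yz' zn.
  move: (bumped _ _ _) yz' => y' yz'; rewrite /ins; have := cm y' x; have := cm z y'.
  by do ![case: ifP => ?]; lia.
have := xz; rewrite ltnNge bumped_leE // => cxz.
have -> : bumped n (ins (ins c x) z) y = z.
  apply/eqP; rewrite eqn_leq; apply/andP; split.
    by rewrite bumped_leE // /ins; do ![case: ifP => ?]; lia.
  rewrite leqNgt; apply/negP => H.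
  have := leqnn (bumped n (ins (ins c x) z) y).
  rewrite {1}bumped_leE //; last by lia.
  move: (bumped _ _ _) H => y' H; rewrite /ins; have := cm y' z; have := cm y' x.
  by do ![case: ifP => ?]; lia.
have -> : bumped n (ins c z) x = z.
  have cm3 := ins_mono z cm.
  apply/eqP; rewrite eqn_leq; apply/andP; split.
    by rewrite bumped_leE // /ins; do ![case: ifP => ?]; lia.
  rewrite leqNgt; apply/negP => H.
  have := leqnn (bumped n (ins c z) x).
  rewrite {1}bumped_leE //; last by lia.
  move: (bumped _ _ _) H => y' H; rewrite /ins; have := cm y' z.
  by do ![case: ifP => ?]; lia.
have -> : bumped n c z = bumped n c x.
  by apply: bumped_eq => // i ni; have := cm x z; lia.
have -> : bumped n (ins (ins c z) x) y = bumped n (ins c x) z.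
  apply: bumped_eq => // i ni; rewrite /ins; have := cm i z; have := cm z i.
  have := cm i x; have := cm x i; have := cm y i; have := cm i y.
  by do ![case: ifP => ?]; lia.
case: (leqP (bumped n (ins c x) z) n) => zn'; last first.
  by apply: (@Knuth_cat _ [:: _] [:: _] [:: _; _]); [apply: Knuth_refl|apply/Knuth_sym/Knuth_inert].
by apply: Knuth_left => //; apply: bumped_homo => //; lia.
Qed.

Lemma knuth_row n w w' c c' : knuth n w w' -> mono c -> mono c' -> eq_upto n c c' ->
  eq_upto n (row_result c w) (row_result c' w') /\
  knuth n (row_output n c w) (row_output n c' w').
Proof.
move=> K; elim: K c c' => {w w'}.
- move=> a z nz c c' cm cm' cc; have [A B] := eq_upto_row [:: z; a] cc.
  have [C D] := @knuth_row_inert n c a z cm nz; rewrite -B; split=> // i ni.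
  by rewrite C // A.
- move=> x y z xy yz c c' cm cm' cc; have [A B] := eq_upto_row [:: y; x; z] cc.
  rewrite -B; suff [C D] : eq_upto n (row_result c [:: y; z; x]) (row_result c [:: y; x; z]) /\
    knuth n (row_output n c [:: y; z; x]) (row_output n c [:: y; x; z]).
    by split=> // i ni; rewrite C // A.
  case: (leqP z n) => zn; first exact: knuth_row_left.
  have [C D] := @knuth_row_inert n (ins c y) x z (ins_mono y cm) zn.
  split; first by move=> i ni; apply/esym/C.
  by apply: (@Knuth_cat _ [:: _] [:: _]); [apply: Knuth_refl|apply: Knuth_sym].
- move=> x y z xy yz c c' cm cm' cc; have [A B] := eq_upto_row [:: z; x; y] cc.
  rewrite -B; suff [C D] : eq_upto n (row_result c [:: x; z; y]) (row_result c [:: z; x; y]) /\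
    knuth n (row_output n c [:: x; z; y]) (row_output n c [:: z; x; y]).
    by split=> // i ni; rewrite C // A.
  case: (leqP z n) => zn; first exact: knuth_row_right.
  have [C D] := @knuth_row_inert n c x z cm zn.
  have [E F] := eq_upto_row [:: y] C.
  split=> //; rewrite (row_output_cat _ _ [:: x; z] [:: y]) (row_output_cat _ _ [:: z; x] [:: y]).
  by rewrite F; apply: Knuth_cat => //; apply: Knuth_refl.
- by move=> w c c' cm cm' cc; have [A ->] := eq_upto_row w cc; split=> //; apply: Knuth_refl.
- move=> u v _ IH c c' cm cm' cc; have [|A B] := IH c' c cm' cm; first by move=> i ni; rewrite cc.
  by split; [move=> i ni; rewrite A | apply: Knuth_sym].
- move=> u v w _ IH1 _ IH2 c c' cm cm' cc; have [A B] := IH1 _ _ cm cm' cc.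
  have [C D] := IH2 c' c' cm' cm' (fun _ _ => erefl).
  by split; [move=> i ni; rewrite A // C | apply: Knuth_trans B D].
move=> u u' v v' _ IH1 _ IH2 c c' cm cm' cc; have [A B] := IH1 _ _ cm cm' cc.
have [C D] := IH2 _ _ (row_result_mono u cm) (row_result_mono u' cm') A.
by rewrite /row_result !foldl_cat !row_output_cat; split=> //; apply: Knuth_cat.
Qed.

Lemma knuth_act n J w w' : knuth n w w' -> (forall j, mono (J j)) ->
  forall j, eq_upto n (act n J w j) (act n J w' j).
Proof.
move=> K Jm j; have [] // := @knuth_row n (arriving n J w j) (arriving n J w' j) (J j) (J j) => //.
by elim: j => //= j IH; have [] := knuth_row IH (Jm j) (Jm j) (fun _ _ => erefl).
Qed.

(** * Insertion of tableaux *)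

Definition counts (J : seq (seq nat)) (j : nat) : nat -> nat := cum (nth [::] J j).

Definition row_sorted (n : nat) (s : seq nat) : bool :=
  sorted leq s && all (fun a => a <= n) s.

Lemma counts_mono J j : mono (counts J j).
Proof. exact: cum_mono. Qed.

Lemma cum_size n s : all (fun a => a <= n) s -> cum s n = size s.
Proof. by move=> sn; apply/eqP; rewrite -all_count. Qed.

Definition row_put (s : seq nat) (a : nat) : seq nat :=
  set_nth 0 s (find (fun b => a < b) s) a.

Lemma row_put_cons x s a :
  row_put (x :: s) a = if a < x then a :: s else x :: row_put s a.
Proof. by rewrite /row_put /=; case: ifP. Qed.

Lemma set_nth_size (s : seq nat) a : set_nth 0 s (size s) a = rcons s a.
Proof. by elim: s => //= x s ->. Qed.

Lemma row_insertE s T a :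
  row_insert (s :: T) a =
  row_put s a :: (if has (fun b => a < b) s
                  then row_insert T (nth 0 s (find (fun b => a < b) s)) else T).
Proof.
rewrite /= /row_put has_find; case: ltnP => // H.
suff -> : find (fun b => a < b) s = size s by rewrite set_nth_size.
by apply/eqP; rewrite eqn_leq find_size.
Qed.

Lemma path_row_put y s a : path leq y s -> y <= a -> path leq y (row_put s a).
Proof.
elim: s y => [|x s IH] y; first by rewrite /= => _ ->.
rewrite row_put_cons => /= /andP[yx xs] ya; case: ltnP => ax /=.
  by rewrite ya /= (path_le leq_trans (ltnW ax)).
by rewrite yx IH.
Qed.

Lemma row_put_sorted n s a : row_sorted n s -> a <= n -> row_sorted n (row_put s a).
Proof.
move=> /andP[ss sn] an; apply/andP; split.
  case: s ss {sn} => [//|x s] xs; rewrite row_put_cons; case: ltnP => ax /=.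
    by rewrite (path_le leq_trans (ltnW ax)).
  exact: path_row_put.
elim: s sn {ss} => [|x s IH]; first by rewrite /= an.
by rewrite row_put_cons => /= /andP[xn sn]; case: ifP => _ /=; rewrite ?an ?xn //= IH.
Qed.

Lemma cum_row_put s a i : sorted leq s -> cum (row_put s a) i = ins (cum s) a i.
Proof.
elim: s => [|x s IH] xs; first by rewrite /ins /cum /=; case: leqP.
rewrite row_put_cons; case: ltnP => ax; last first.
  rewrite cum_cons IH ?(path_sorted xs) // /ins !cum_cons.
  by case: (leqP a i) => ai; case: (leqP x i); lia.
move: xs; rewrite /= (path_sortedE leq_trans) => /andP[xs _].
have E k : k < x -> cum s k = 0.
  by move=> kx; apply: cum_eq0; apply: sub_all xs => b; lia.
rewrite /ins !cum_cons (E a) //; have := E i.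
by case: (leqP a i) => ai; case: (leqP x i); lia.
Qed.

Lemma bumped_row n s a : row_sorted n s -> a <= n ->
  bumped n (cum s) a =
  if has (fun b => a < b) s then nth 0 s (find (fun b => a < b) s) else n.+1.
Proof.
move=> /andP[ss sn] an; elim: s ss sn => [|x s IH] xs.
  move=> _; have := bumped_ltn (cum_mono [::]) an; have := bumped_le (cum [::]) an.
  have := @bumped_leE n _ a n (cum_mono [::]) an (leqnn n); rewrite /cum /=; lia.
move=> /= /andP[xn sn]; case: ltnP => ax /=; last first.
  rewrite -IH ?(path_sorted xs) //; apply: bumped_eq => // i ni.
  rewrite !cum_cons ax; have := @cum_mono s i a; case: (leqP x i); lia.
have cx := cum_mono (x :: s).
have E k : k < x -> cum (x :: s) k = 0.
  move=> kx; apply: cum_eq0; move: xs; rewrite /= (path_sortedE leq_trans) => /andP[xs _].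
  by rewrite kx; apply: sub_all xs => b; lia.
apply/eqP; rewrite eqn_leq; apply/andP; split.
  by rewrite bumped_leE // (E a) // cum_cons leqnn.
rewrite leqNgt; apply/negP => H.
by have := leqnn (bumped n (cum (x :: s)) a); rewrite {1}bumped_leE ?E //; lia.
Qed.

Lemma act_inert n J a j : n < a -> eq_upto n (act n J [:: a] j) (J j).
Proof.
move=> na i ni; have -> : act n J [:: a] j = ins (J j) a.
  rewrite /act; suff -> : arriving n J [:: a] j = [:: a] by [].
  by elim: j => //= j ->; rewrite /= bumped_inert.
by rewrite /ins leqNgt (leq_ltn_trans ni na).
Qed.

Lemma arriving_behead n J w j :
  arriving n J w j.+1 = arriving n (fun j => J j.+1) (row_output n (J 0) w) j.
Proof. by elim: j => //= j ->. Qed.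

Lemma counts_row_insert n J a : all (row_sorted n) J -> a <= n ->
  all (row_sorted n) (row_insert J a) /\
  forall j, eq_upto n (counts (row_insert J a) j) (act n (counts J) [:: a] j).
Proof.
elim: J a => [|s J IH] a.
  move=> _ an; split; first by rewrite /= /row_sorted /= an.
  have E c : eq_upto n c (fun=> 0) -> eq_upto n (ins c a) (cum [:: a]).
    by move=> c0 i ni; rewrite /ins !c0 // /cum /=; case: leqP.
  case=> [|j] i ni; first by rewrite /act /= E.
  have <- : counts [::] j.+1 i = counts (row_insert [::] a) j.+1 i.
    by rewrite /counts /= nth_nil.
  rewrite /act arriving_behead /= -[RHS]/(act n (fun j => counts [::] j.+1) _ j i).
  by rewrite act_inert // bumped_row.
rewrite row_insertE => /= /andP[ss sJ] an; have [s1 s2] := andP ss.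
have an' : all (row_sorted n) J -> forall b, b <= n -> _ := fun h b bn => IH b h bn.
have E0 : eq_upto n (cum (row_put s a)) (ins (cum s) a) by move=> i _; apply: cum_row_put.
have EJ j : act n (counts (s :: J)) [:: a] j.+1 =
   act n (counts J) [:: bumped n (cum s) a] j by rewrite /act arriving_behead.
rewrite row_put_sorted //=.
case: ifP => hs; last first.
  split=> // -[|j] i ni; first exact: E0.
  by rewrite EJ act_inert // bumped_row // hs.
have [|A B] := IH (nth 0 s (find (fun b => a < b) s)) sJ.
  by apply: (allP s2); rewrite mem_nth // -has_find.
split=> // -[|j] i ni; first exact: E0.
by rewrite EJ bumped_row // hs; apply: B.
Qed.

Lemma counts_insert_word n J w : all (row_sorted n) J -> all (fun a => a <= n) w ->
  all (row_sorted n) (foldl row_insert J w) /\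
  forall j, eq_upto n (counts (foldl row_insert J w) j) (act n (counts J) w j).
Proof.
elim: w J => [|a w IH] J sJ /=.
  move=> _; split=> // j i _; rewrite /act; suff -> : arriving n (counts J) [::] j = [::] by [].
  by elim: j => //= j ->.
move=> /andP[an wn].
have [A B] := counts_row_insert sJ an; have [C D] := IH _ A wn.
split=> // j i ni; rewrite D // -cat1s act_cat.
exact: eq_upto_act.
Qed.

Definition row_sum (J : seq (seq nat)) (j i : nat) : nat := \sum_(r < j) counts J r i.

Lemma row_sum0 J i : row_sum J 0 i = 0.
Proof. by rewrite /row_sum big_ord0. Qed.

Lemma row_sumS J j i : row_sum J j.+1 i = row_sum J j i + counts J j i.
Proof. by rewrite /row_sum big_ord_recr. Qed.

Section Insertion.

Variables (n : nat) (T U : seq (seq nat)).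
Hypothesis sT : all (row_sorted n) T.
Hypothesis sU : all (row_sorted n) U.
Hypothesis szU : size U = n.

Local Notation stage := (insertion_stage T U).

Lemma insertion_stageS k : k < n ->
  stage k = foldl row_insert (stage k.+1) (nth [::] U k).
Proof.
move=> kn; rewrite /insertion_stage (drop_nth [::]) ?szU // rev_cons.
by rewrite -cats1 foldl_cat.
Qed.

Lemma nth_row_sorted (V : seq (seq nat)) k : all (row_sorted n) V -> row_sorted n (nth [::] V k).
Proof.
move=> sV; case: (ltnP k (size V)) => kV; last by rewrite nth_default.
by apply: (allP sV); apply: mem_nth.
Qed.

Lemma stage_sorted k : all (row_sorted n) (stage k).
Proof.
rewrite /insertion_stage; have : all (row_sorted n) (rev (drop k U)).
  by rewrite all_rev; apply/allP => s /mem_drop; apply: (allP sU).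
elim: (rev _) (T) sT => //= s ss IH J sJ /andP[/andP[_ sn] sss].
by apply: IH => //; have [] := counts_insert_word sJ sn.
Qed.

Lemma stage_act k : k < n ->
  forall j, eq_upto n (counts (stage k) j) (act n (counts (stage k.+1)) (nth [::] U k) j).
Proof.
move=> kn; rewrite insertion_stageS //; have /andP[_ H] := nth_row_sorted k sU.
by have [] := counts_insert_word (stage_sorted k.+1) H.
Qed.

Definition partial_sum (k i j : nat) : nat :=
  row_sum (stage k) j i + row_sum U k i.

Local Notation arr k j := (cum (arriving n (counts (stage k.+1)) (nth [::] U k) j)).

Lemma partial_sum_arriving k i j : k < n -> i <= n ->
  partial_sum k i j + arr k j i = partial_sum k.+1 i j.
Proof.
move=> kn ni; rewrite /partial_sum; elim: j => [|j IH].
  by rewrite !row_sum0 !add0n row_sumS.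
rewrite !row_sumS in IH *; rewrite (stage_act kn) // /act.
have := row_conservation (arriving n (counts (stage k.+1)) (nth [::] U k) j)
  (counts_mono (stage k.+1) j) ni; rewrite /=; move: IH; lia.
Qed.

Lemma partial_sum_octahedron k i j : k < n -> 0 < i <= n ->
  partial_sum k i j.+1 + partial_sum k.+1 i.-1 j =
  maxn (partial_sum k i.-1 j.+1 + partial_sum k.+1 i j)
       (partial_sum k.+1 i j.+1 + partial_sum k i.-1 j).
Proof.
move=> kn /andP[i0 ni]; have ni1 : i.-1 <= n by lia.
have E1 := partial_sum_arriving j kn ni; have E2 := partial_sum_arriving j kn ni1.
have S m h : partial_sum m h j.+1 = partial_sum m h j + counts (stage m) j h.
  by rewrite /partial_sum row_sumS; lia.
have /andP[us _] := nth_row_sorted k sU.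
have := row_result_rec (counts_mono (stage k.+1) j)
   (sorted_arriving n j (fun j => counts_mono (stage k.+1) j) us) i0.
have := @stage_act k kn j i ni; have := @stage_act k kn j i.-1 ni1; rewrite /act !S; lia.
Qed.

Hypothesis lowU : forall r i, i <= r -> counts U r i = 0.

Lemma arriving_eq0 k i j : k < n -> i <= n -> i <= k + j -> arr k j i = 0.
Proof.
move=> kn; elim: j i => [|j IH] i ni ikj; first by rewrite /= -/(counts _ _) lowU //; lia.
have /andP[us _] := nth_row_sorted k sU.
have [i0|i0] := posnP i.
  have := row_conservation (arriving n (counts (stage k.+1)) (nth [::] U k) j)
    (counts_mono (stage k.+1) j) ni.
  have := row_result_ge (counts (stage k.+1) j) (arriving n (counts (stage k.+1)) (nth [::] U k) j) i.
  by rewrite (IH i ni) /=; lia.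
have := row_result_rec (counts_mono (stage k.+1) j)
   (sorted_arriving n j (fun j => counts_mono (stage k.+1) j) us) i0.
have := row_conservation (arriving n (counts (stage k.+1)) (nth [::] U k) j)
  (counts_mono (stage k.+1) j) ni.
by have := IH i.-1; rewrite /=; lia.
Qed.

Lemma partial_sum_boundary k i j : k <= n -> i <= n -> i <= k + j ->
  partial_sum k i j = row_sum T j i + row_sum U n i.
Proof.
move=> + ni; move: {2}(n - k) (erefl (n - k)) => d; elim: d k => [|d IH] k dk kn ikj.
  have -> : k = n by lia.
  rewrite /partial_sum; suff -> : stage n = T by [].
  by rewrite /insertion_stage drop_oversize // szU.
have kn' : k < n by lia.
rewrite -(IH k.+1); try lia.
by rewrite -(partial_sum_arriving j kn' ni) arriving_eq0 // addn0.
Qed.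

Lemma sumn_shape_row_insert J a : sumn (shape (row_insert J a)) = (sumn (shape J)).+1.
Proof.
elim: J a => [|s J IH] a //; rewrite row_insertE /= /row_put size_set_nth has_find.
have := find_size (fun b => a < b) s.
by case: ltnP => H /=; rewrite ?IH /maxn; case: ifP; lia.
Qed.

Lemma sumn_shape_insert_word J w :
  sumn (shape (foldl row_insert J w)) = sumn (shape J) + size w.
Proof. by elim: w J => [|a w IH] J /=; rewrite ?IH ?sumn_shape_row_insert; lia. Qed.

Lemma sumn_drop_shape k j :
  sumn (drop j (shape (stage k))) + row_sum (stage k) j n =
  sumn (shape (stage k)).
Proof.
elim: j => [|j IH]; first by rewrite row_sum0 drop0 addn0.
rewrite -{}IH row_sumS.
have /andP[_ H] := nth_row_sorted j (stage_sorted k).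
rewrite /counts (cum_size H); case: (ltnP j (size (stage k))) => jk; last first.
  by rewrite nth_default // !drop_oversize ?size_map ?addn0 // leqW.
rewrite (drop_nth 0 (n := j)) ?size_map // (nth_map [::]) //=; lia.
Qed.

Lemma recordingE i j : 1 <= j <= i -> i <= n ->
  (recording T U i j + (partial_sum (i - j).+1 n j.-1)%:Z = (partial_sum (i - j) n j)%:Z)%R.
Proof.
move=> /andP[j0 ji] ni; rewrite /recording addn1.
have ijn : i - j < n by lia.
have := sumn_drop_shape (i - j) j; have := sumn_drop_shape (i - j).+1 j.-1.
rewrite {3}(insertion_stageS ijn) sumn_shape_insert_word /partial_sum.
have /andP[_ H] := nth_row_sorted (i - j) sU.
rewrite !row_sumS /counts (cum_size H) -/counts; lia.
Qed.

End Insertion.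

(** * The octahedron recurrence *)

Lemma tableau_row_sorted n T : is_tableau n T -> all (row_sorted n) T.
Proof.
move=> [_ Ts _]; apply/allP => s sT; have [ss sn] := Ts s sT.
by rewrite /row_sorted ss; apply/allP => a /sn /andP[].
Qed.

Lemma tableau_entry_gt n T r c : is_tableau n T ->
  c < size (nth [::] T r) -> r < nth 0 (nth [::] T r) c.
Proof.
move=> [_ Ts Tc]; elim: r => [|r IH] cr.
  have r0 : nth [::] T 0 \in T by apply: mem_nth; case: (T) cr; rewrite ?nth_nil.
  by have [_ /(_ _ (mem_nth 0 cr)) /andP[]] := Ts _ r0.
by have [cr' H] := Tc r c cr; apply: leq_ltn_trans (IH cr') H.
Qed.

Lemma tableau_counts_eq0 n T r i : is_tableau n T -> i <= r -> counts T r i = 0.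
Proof.
move=> hT ir; apply: cum_eq0; apply/(all_nthP 0) => c cr.
exact: leq_ltn_trans ir (tableau_entry_gt hT cr).
Qed.

Section Octahedron.

Import GRing.Theory.
Local Open Scope ring_scope.

Lemma hat_telescope n M T i j : tableau_of n (hat n M) T -> (j <= i <= n)%N ->
  (row_sum T j i)%:Z = M (i - j)%N j (n - i)%N - M i 0%N (n - i)%N.
Proof.
move=> [_ hT] /andP[+ ni]; elim: j => [|j IH] ji.
  by rewrite row_sum0 subn0 subrr.
rewrite row_sumS PoszD IH; last exact: ltnW.
have := @hT i j.+1; rewrite ji => /(_ isT ni); rewrite /pattern /hat /= -/(cum _ _).
rewrite -/(counts T j i) => ->.
have -> : (i - j.+1 + 1 = i - j)%N by lia.
by rewrite addrC addrA subrK.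
Qed.

Lemma tableau_row_sum n T i : is_tableau n T -> (i <= n)%N ->
  row_sum T n i = row_sum T i i.
Proof.
move=> hT ni; rewrite -(subnKC ni); elim: (n - i)%N => [|d IH]; first by rewrite addn0.
by rewrite addnS row_sumS IH (tableau_counts_eq0 hT) ?addn0 // leq_addr.
Qed.

Variables (n : nat) (M N : nat -> nat -> nat -> int) (T U : seq (seq nat)).
Hypothesis MN : matching n M N.
Hypothesis hT : tableau_of n (hat n M) T.
Hypothesis hU : tableau_of n (hat n N) U.

Lemma octahedronE t x y : octahedron n M N t x y =
  if y == (x + t)%N then M x t (n - y)%N
  else if x == (y + t)%N then N t y (n - x)%N
  else if t is t1.+1 then
    if t1 is t2.+1 then
      Num.max (octahedron n M N t1 x.+1 y + octahedron n M N t1 x.-1 y)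
              (octahedron n M N t1 x y.+1 + octahedron n M N t1 x y.-1)
      - octahedron n M N t2 x y
    else 0
  else 0.
Proof. by case: t. Qed.

Let sT := tableau_row_sorted (proj1 hT).
Let sU := tableau_row_sorted (proj1 hU).
Let szU : size U = n := let: And3 H _ _ := proj1 hU in H.
Let lowU r i : (i <= r)%N -> counts U r i = 0%N := tableau_counts_eq0 (proj1 hU) (i := i).

(* The octahedron recurrence at time t, restricted to the line x + y = i + k with
   t = i - k, is the tropical insertion of the rows of index > k, restricted to
   the letters <= i. *)
Lemma octahedron_partial_sum k i j : (k <= i <= n)%N -> (j + k <= i)%N ->
  octahedron n M N (i - k) (i - j) (j + k) =
  (partial_sum T U k i j)%:Z + N i 0%N (n - i)%N.
Proof.
move=> /andP[ki ni].
have [t] := ubnP (i - k)%N; elim: t k i j ki ni => // t IH k i j ki ni it jki.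
have kn : (k <= n)%N := leq_trans ki ni.
have [j0|j0] := eqVneq (j + k)%N i.
  rewrite (partial_sum_boundary sT sU szU lowU kn ni); last by lia.
  have -> : (i - k = j)%N by lia.
  have -> : (i - j = k)%N by lia.
  have -> : octahedron n M N j k (j + k) = M k j (n - i).
    by rewrite j0 octahedronE -j0 addnC eqxx.
  have A := @hat_telescope n M T i j hT; have B := @hat_telescope n N U i i hU.
  move: A B; rewrite (_ : i - j = k)%N; last by lia.
  rewrite subnn leqnn ni andbT (tableau_row_sum (proj1 hU) ni) PoszD => -> => [->|]; last by lia.
    by rewrite (MN ni); ring.
  by [].
rewrite octahedronE.
have -> : ((j + k == i - j + (i - k)) = false)%N by lia.
have [E|E] := eqVneq (i - j)%N (j + k + (i - k))%N.
  have -> : (j = 0)%N by lia.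
  have := @hat_telescope n N U i k hU; rewrite ki ni /partial_sum row_sum0 add0n subn0 => -> //.
  by rewrite subrK.
case: j => [|j] in jki j0 E *; first by lia.
have [t1 Et] : exists t1, (i - k = t1.+2)%N by exists (i - k).-2%N; lia.
rewrite Et.
have kn' : (k < n)%N by lia.
have := @partial_sum_octahedron n T U sT sU szU k i j kn'.
have -> : (0 < i <= n)%N by lia.
have := IH k.+1 i j; have := IH k i.-1 j.+1; have := IH k.+1 i j.+1; have := IH k i.-1 j.
have := IH k.+1 i.-1 j.
have -> : (i - k.+1 = t1.+1)%N by lia.
have -> : (i.-1 - k = t1.+1)%N by lia.
have -> : (i.-1 - k.+1 = t1)%N by lia.
have -> : (i - j = (i - j.+1).+1)%N by lia.
have -> : (i.-1 - j.+1 = (i - j.+1).-1)%N by lia.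
have -> : (i.-1 - j = i - j.+1)%N by lia.
have -> : ((j.+1 + k.+1 = (j.+1 + k).+1))%N by lia.
have -> : ((j + k.+1 = j.+1 + k))%N by lia.
have -> : ((j + k = (j.+1 + k).-1))%N by lia.
do 5 (move=> ->; [|by clear -jki j0 ki ni it Et kn'; lia..]).
move=> /(_ isT) /=; move: (partial_sum _ _ _ _ _) (N _ _ _); clear; lia.
Qed.

Lemma recording_hat : eq_pattern n (recording T U) (hat n (octa_P n M N)).
Proof.
move=> i j ij ni; have := recordingE sT sU szU ij ni; rewrite /hat /octa_P.
have -> : (i - j + 1 = (i - j).+1)%N by lia.
have {1}-> : (n - (n - i) = j + (i - j))%N by lia.
have -> : (n - (n - i) = j.-1 + (i - j).+1)%N by lia.
rewrite !octahedron_partial_sum; lia.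
Qed.

Lemma hat_octa_Q i j : (1 <= j <= i)%N -> (i <= n)%N ->
  hat n (octa_Q n M N) i j = (counts (insertion_stage T U 0) j.-1 i)%:Z.
Proof.
case: j => [|j] // /andP[_ ji] ni; rewrite /hat /octa_Q subKn //=.
have -> : (i - j.+1 + 1 = i - j)%N by lia.
have := octahedron_partial_sum (k := 0) (i := i) (j := j.+1).
have := octahedron_partial_sum (k := 0) (i := i) (j := j).
rewrite !addn0 subn0 ni => -> //; last exact: ltnW.
by move=> -> //; rewrite /partial_sum row_sumS; lia.
Qed.

End Octahedron.

(** * Reading words *)

Fixpoint reading (f : nat -> seq nat) (R : nat) : seq nat :=
  if R is R'.+1 then f R' ++ reading f R' else [::].

Lemma eq_reading f g R : (forall r, r < R -> f r = g r) -> reading f R = reading g R.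
Proof.
by elim: R => //= R IH fg; rewrite fg // IH // => r rR; apply: fg; apply: ltnW.
Qed.

Lemma reading_add f m k :
  reading f (k + m) = reading (fun r => f (k + r)) m ++ reading f k.
Proof. by elim: m => [|m IH]; rewrite ?addn0 // addnS /= IH catA. Qed.

Lemma reading_nth T : reading (nth [::] T) (size T) = flatten (rev T).
Proof.
elim/last_ind: T => // T s IH; rewrite size_rcons /= nth_rcons ltnn eqxx rev_rcons /= -IH.
by congr (_ ++ _); apply: eq_reading => r rT; rewrite nth_rcons rT.
Qed.

Lemma knuth_reading n f g r R : r.+1 < R ->
  (forall k, k != r -> k != r.+1 -> f k = g k) ->
  knuth n (f r.+1 ++ f r) (g r.+1 ++ g r) -> knuth n (reading f R) (reading g R).
Proof.
move=> rR fg K; elim: R rR => // R IH; rewrite ltnS leq_eqVlt => /orP[/eqP <-|rR] /=.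
  rewrite !catA; apply: Knuth_cat => //.
  have -> : reading f r = reading g r by apply: eq_reading => k kr; apply: fg; lia.
  exact: Knuth_refl.
by apply: Knuth_cat; [rewrite fg; [exact: Knuth_refl|lia|lia] | apply: IH].
Qed.

Lemma knuth_catl n u v v' : knuth n v v' -> knuth n (u ++ v) (u ++ v').
Proof. by apply: Knuth_cat; apply: Knuth_refl. Qed.

Lemma knuth_catr n u u' v : knuth n u u' -> knuth n (u ++ v) (u' ++ v).
Proof. by move=> K; apply: Knuth_cat K _; apply: Knuth_refl. Qed.

Lemma knuth_push n c a w v : a < c -> path leq c w ->
  knuth n (c :: w ++ a :: v) (c :: a :: w ++ v).
Proof.
elim: w c v => [|x w IH] c v ac /=; first by move=> _; apply: Knuth_refl.
move=> /andP[cx xw].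
apply: Knuth_trans (knuth_catl [:: c] (IH _ v (leq_trans ac cx) xw)) _.
exact: (knuth_catr (w ++ v) (Knuth_left n ac cx)).
Qed.

Fixpoint dominates (D B : seq nat) : bool :=
  if D is d :: D' then if B is b :: B' then (b < d) && dominates D' B' else false
  else true.

Lemma dominates_cons D B b : path leq b B -> dominates D B -> dominates D (b :: B).
Proof.
elim: D B b => //= d D IH [|b' B] b //= /andP[bb' b'B] /andP[b'd DB].
by rewrite (leq_ltn_trans bb' b'd) /=; apply: IH.
Qed.

Lemma knuth_lift n b D B : dominates D B -> path leq b B -> path leq b D ->
  knuth n (b :: D ++ B) (D ++ b :: B).
Proof.
elim: D b B => [|d D IH] b [|b1 B] //; try by move=> *; apply: Knuth_refl.
move=> /= /andP[b1d DB] /andP[bb1 b1B] /andP[bd dD].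
apply: Knuth_trans (knuth_catl [:: b] (knuth_push n B b1d dD)) _.
apply: Knuth_trans (knuth_catr (D ++ B) (Knuth_right n bb1 b1d)) _.
apply: (knuth_catl [:: d]) => /=.
apply: Knuth_trans (knuth_catl [:: b] (IH b1 B DB b1B _)) _.
  by rewrite (path_le leq_trans (ltnW b1d)).
apply: IH; first exact: dominates_cons.
  by rewrite /= bb1.
by rewrite (path_le leq_trans bd).
Qed.

(* The words of two adjacent rows before and after the letter b moves up into the hole
   of the upper one; the lower row is C b D, the upper row is A _ B. *)
Lemma knuth_slide_down n C A b D B : all2 ltn A C -> sorted leq (C ++ b :: D) ->
  path leq b B -> dominates D B ->
  knuth n ((C ++ b :: D) ++ A ++ B) ((C ++ D) ++ A ++ b :: B).
Proof.
move=> AC; have := AC; rewrite all2E => /andP[_ _].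
elim: C A AC => [|c C IH] [|a A] //=.
  by move=> _ bD bB DB; apply: knuth_lift.
move=> /andP[ac AC] cCD bB DB.
have cD : path leq c (C ++ D).
  by apply: subseq_path cCD; [exact: leq_trans|rewrite subseq_cat2l ?cat_subseq ?subseq_cons].
apply: Knuth_trans (knuth_push n (A ++ B) ac cCD) _.
apply: Knuth_trans _ (Knuth_sym (knuth_push n (A ++ b :: B) ac cD)).
by apply: (knuth_catl [:: c; a]); apply: IH => //; apply: path_sorted cCD.
Qed.

Lemma sorted_map_iota (f : nat -> nat) s m :
  (forall x y, s <= x -> x <= y -> y < s + m -> f x <= f y) ->
  sorted leq [seq f x | x <- iota s m].
Proof.
move=> H; apply: (@homo_sorted_in _ _ (mem (iota s m)) f leq leq); last exact: iota_sorted.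
  by move=> x y; rewrite /= !mem_iota => /andP[sx _] /andP[_ ys] xy; apply: H.
by apply/allP => x.
Qed.

Lemma dominates_map_iota (f g : nat -> nat) s m m' : m <= m' ->
  (forall x, s <= x < s + m -> g x < f x) ->
  dominates [seq f x | x <- iota s m] [seq g x | x <- iota s m'].
Proof.
elim: m m' s => //= m IH [|m'] s // mm' H /=; rewrite H ?IH //; try lia.
by move=> x ?; apply: H; lia.
Qed.

Lemma act_row n J (V : nat -> seq nat) :
  (forall j, mono (J j)) -> (forall r, sorted leq (V r)) ->
  (forall r, cum (V r) 0 = 0) ->
  (forall r i, 0 < i -> cum (V r.+1) i <= cum (V r) i.-1) ->
  (forall j, eq_upto n (J j) (cum (V j.+1))) ->
  forall j, eq_upto n (act n J (V 0) j) (cum (V j)).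
Proof.
move=> Jm Vs V0 VS JV; have sa j := sorted_arriving n j Jm (Vs 0).
have rowE j : eq_upto n (cum (arriving n J (V 0) j)) (cum (V j)) ->
    eq_upto n (act n J (V 0) j) (cum (V j)).
  move=> W; elim=> [|i IH] ni.
    have := row_conservation (arriving n J (V 0) j) (Jm j) ni.
    by rewrite JV // W // !V0 /act; lia.
  have := row_result_rec (Jm j) (sa j) (ltn0Sn i).
  rewrite -/(act n J (V 0) j) IH ?W ?JV //=; try exact: ltnW.
  have := VS j i.+1 isT; have := @cum_mono (V j) i i.+1 (leqnSn i); rewrite /=; lia.
move=> j; apply/rowE; elim: j => [|j IH] i ni //=.
have := row_conservation (arriving n J (V 0) j) (Jm j) ni.
by rewrite -/(act n J (V 0) j i) rowE // IH // JV //; lia.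
Qed.

Lemma act_reading n (V : nat -> seq nat) R :
  (forall r, sorted leq (V r)) -> (forall r, cum (V r) 0 = 0) ->
  (forall r i, 0 < i -> cum (V r.+1) i <= cum (V r) i.-1) ->
  (forall r, R <= r -> V r = [::]) ->
  forall j, eq_upto n (act n (fun _ _ => 0) (reading V R) j) (cum (V j)).
Proof.
elim: R V => [|R IH] V Vs V0 VS VR j i ni.
  rewrite VR // /act; suff -> : arriving n (fun _ _ => 0) (reading V 0) j = [::] by [].
  by elim: (j) => //= k ->.
rewrite -add1n reading_add act_cat /= cats0; apply: act_row => //.
  by move=> k; apply: act_mono.
by move=> k; apply: (IH (fun r => V r.+1)) => // r; [exact: (VS r.+1) | exact: (VR r.+1)].
Qed.

(** * Jeu de taquin slides *)

Definition val_at (F : filling) (r c : nat) : nat := odflt 0 (F r c).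

Definition no_hole : nat -> nat -> bool := fun _ _ => false.

Definition hole_at (r c : nat) : nat -> nat -> bool := fun r' c' => (r' == r) && (c' == c).

(* A semistandard filling of the cells lo r <= c < hi r outside the hole h, with
   letters in {1..n} and rows below R empty; F is arbitrary in the hole. *)
Record skew_filling (n R : nat) (lo hi : nat -> nat) (h : nat -> nat -> bool)
    (F : filling) : Prop :=
  Skew {
  skew_lo : forall r, lo r.+1 <= lo r;
  skew_hi : forall r, hi r.+1 <= hi r;
  skew_lo_hi : forall r, lo r <= hi r;
  skew_bound : hi R = 0;
  skew_cell : forall r c, ~~ h r c ->
    F r c = if lo r <= c < hi r then Some (val_at F r c) else None;
  skew_letter : forall r c, lo r <= c < hi r -> ~~ h r c -> 1 <= val_at F r c <= n;
  skew_row : forall r c c', lo r <= c -> c <= c' -> c' < hi r ->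
    ~~ h r c -> ~~ h r c' -> val_at F r c <= val_at F r c';
  skew_col : forall r r' c, r < r' -> lo r <= c -> c < hi r' ->
    ~~ h r c -> ~~ h r' c -> val_at F r c < val_at F r' c
}.

Definition row_word (F : filling) (lo hi : nat -> nat) (h : nat -> nat -> bool) (r : nat) :
    seq nat :=
  [seq val_at F r c | c <- iota (lo r) (hi r - lo r) & ~~ h r c].

Lemma val_put F r c a r' c' :
  val_at (put F r c (Some a)) r' c' = if hole_at r c r' c' then a else val_at F r' c'.
Proof. by rewrite /val_at /put /hole_at; case: ifP. Qed.

Lemma le_homo (f : nat -> nat) r r' : (forall k, f k.+1 <= f k) -> r <= r' -> f r' <= f r.
Proof.
move=> H; elim: r' => [|k IH] rk; first by have -> : r = 0 by lia.
move: rk; rewrite leq_eqVlt => /orP[/eqP -> //|rk]; exact: leq_trans (H k) (IH rk).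
Qed.

Lemma skew_bound_le n R lo hi h F r : skew_filling n R lo hi h F -> R <= r -> hi r = 0.
Proof. by move=> S Rr; have := le_homo (skew_hi S) Rr; rewrite (skew_bound S); lia. Qed.

Lemma row_word_plain F lo hi h r : (forall c, ~~ h r c) ->
  row_word F lo hi h r = [seq val_at F r c | c <- iota (lo r) (hi r - lo r)].
Proof. by move=> H; rewrite /row_word (eq_filter (a2 := predT)) // filter_predT. Qed.

Lemma iota_split s m c : s <= c <= s + m -> iota s m = iota s (c - s) ++ iota c (s + m - c).
Proof.
move=> /andP[sc cm]; have {1}-> : m = (c - s) + (s + m - c) by lia.
by rewrite iotaD subnKC.
Qed.

Lemma row_word_hole F lo hi r c : lo r <= c < hi r ->
  row_word F lo hi (hole_at r c) r =
  [seq val_at F r x | x <- iota (lo r) (c - lo r)] ++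
  [seq val_at F r x | x <- iota c.+1 (hi r - c.+1)].
Proof.
move=> /andP[lc ch]; rewrite /row_word (@iota_split _ _ c); last by lia.
have -> : lo r + (hi r - lo r) - c = (hi r - c.+1).+1 by lia.
rewrite filter_cat map_cat /= /hole_at !eqxx /=.
congr (_ ++ _); congr map; apply/all_filterP/allP => x; rewrite mem_iota; lia.
Qed.

Lemma skew_put_right n R lo hi r c F a :
  skew_filling n R lo hi (hole_at r c) F -> lo r <= c < hi r ->
  F r c.+1 = Some a -> (forall b, F r.+1 c = Some b -> a < b) ->
  [/\ c.+1 < hi r, skew_filling n R lo hi (hole_at r c.+1) (put F r c (Some a)) &
    reading (row_word F lo hi (hole_at r c)) R =
    reading (row_word (put F r c (Some a)) lo hi (hole_at r c.+1)) R].
Proof.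
move=> S /andP[lc ch] Fa Fb; have [lo1 hi1 lh hR cell lett rows cols] := S.
have h1 : ~~ hole_at r c r c.+1 by rewrite /hole_at; lia.
have h2 : ~~ hole_at r c r.+1 c by rewrite /hole_at; lia.
have c1 : c.+1 < hi r by have := cell r c.+1 h1; rewrite Fa; case: ifP => //; lia.
have va : val_at F r c.+1 = a by rewrite /val_at Fa.
have low k : r < k -> c < hi k -> a < val_at F k c.
  move=> rk ck; have H : c < hi r.+1 by have := le_homo hi1 rk; lia.
  have L := lo1 r.
  have Ha : a < val_at F r.+1 c by apply: Fb; rewrite cell //; case: ifP => //; lia.
  case: (ltngtP r.+1 k) => [k1|k1|<- //]; last by lia.
  by apply: ltn_trans Ha _; apply: cols => //; rewrite /hole_at; lia.
have up k : k < r -> lo k <= c -> val_at F k c < a.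
  move=> kr lk; have H := le_homo hi1 (ltnW kr).
  have A : val_at F k c <= val_at F k c.+1 by apply: rows; rewrite /hole_at; lia.
  by apply: leq_ltn_trans A _; rewrite -va; apply: cols => //; rewrite /hole_at; lia.
split=> //; last first.
  apply: eq_reading => k _; have [->|kr] := eqVneq k r; last first.
    rewrite !row_word_plain; try by move=> x; rewrite /hole_at; lia.
    by apply: eq_map => x; rewrite val_put /hole_at (negbTE kr).
  rewrite !row_word_hole; try by lia.
  have -> : c.+1 - lo r = (c - lo r) + 1 by lia.
  have -> : hi r - c.+1 = (hi r - c.+2).+1 by lia.
  rewrite iotaD map_cat -catA subnKC //= val_put /hole_at !eqxx /= va.
  congr (_ ++ _ :: _); apply/eq_in_map => x; rewrite mem_iota val_put /hole_at => ?.
    by rewrite ifF //; lia.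
  by rewrite ifF //; lia.
split=> //.
- move=> k x H; rewrite val_put; case: (boolP (hole_at r c k x)) => H1; last first.
    have -> : put F r c (Some a) k x = F k x by rewrite /put -/(hole_at r c k x) (negbTE H1).
    exact: cell.
  by have /andP[/eqP Ek /eqP Ex] := H1; rewrite /put -/(hole_at r c k x) H1 Ek Ex ifT //; lia.
- move=> k x kx H; rewrite val_put; case: ifP => H1; last by apply: lett => //; rewrite H1.
  by rewrite -va; apply: lett => //; lia.
- move=> k x x' lx xx' x'h H H'; rewrite !val_put; case: ifP => H1; case: ifP => H2 //.
  + move: H1 H2 H'; rewrite /hole_at => H1 H2 H'; rewrite -va.
    have E : k = r by lia.
    by subst k; apply: rows; rewrite /hole_at; lia.
  + move: H1 H2 H; rewrite /hole_at => H1 H2 H; rewrite -va.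
    have E : k = r by lia.
    by subst k; apply: rows; rewrite /hole_at; lia.
  by apply: rows => //; rewrite ?H1 ?H2.
move=> k k' x kk' lx xh H H'; rewrite !val_put; case: ifP => H1; case: ifP => H2 //.
- by move: H1 H2; rewrite /hole_at; lia.
- move: H1 H2; rewrite /hole_at => H1 H2; have -> : x = c by lia.
  by apply: low; lia.
- move: H1 H2; rewrite /hole_at => H1 H2; have E : x = c by lia.
  by rewrite E; apply: up; rewrite -?E; lia.
by apply: (@cols k k') => //; rewrite ?H1 ?H2.
Qed.

Lemma skew_put_down n R lo hi r c F b :
  skew_filling n R lo hi (hole_at r c) F -> lo r <= c < hi r ->
  F r.+1 c = Some b -> (forall a, F r c.+1 = Some a -> b <= a) ->
  [/\ lo r.+1 <= c < hi r.+1, skew_filling n R lo hi (hole_at r.+1 c) (put F r c (Some b)) &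
    knuth n (reading (row_word F lo hi (hole_at r c)) R)
      (reading (row_word (put F r c (Some b)) lo hi (hole_at r.+1 c)) R)].
Proof.
move=> S /andP[lc ch] Fb Fa; have [lo1 hi1 lh hR cell lett rows cols] := S.
have h1 : ~~ hole_at r c r c.+1 by rewrite /hole_at; lia.
have h2 : ~~ hole_at r c r.+1 c by rewrite /hole_at; lia.
have c1 : lo r.+1 <= c < hi r.+1 by have := cell r.+1 c h2; rewrite Fb; case: ifP.
have vb : val_at F r.+1 c = b by rewrite /val_at Fb.
have right x : c < x -> x < hi r -> b <= val_at F r x.
  move=> cx xh.
  have Ha : b <= val_at F r c.+1 by apply: Fa; rewrite cell //; case: ifP => //; lia.
  case: (ltngtP c.+1 x) => [k1|k1|<- //]; last by lia.
  by apply: leq_trans Ha _; apply: rows; rewrite /hole_at; lia.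
have left x : lo r <= x -> x < c -> val_at F r x <= b.
  move=> lx xc.
  have A : val_at F r x < val_at F r.+1 x by apply: cols => //; rewrite /hole_at; lia.
  apply: leq_trans (ltnW A) _; rewrite -vb.
  by apply: rows; rewrite /hole_at; have := lo1 r; lia.
have rR : r.+1 < R by rewrite ltnNge; apply/negP => /(skew_bound_le S); lia.
split=> //; last first.
  apply: (knuth_reading rR) => [k kr kr1|].
    rewrite !row_word_plain; try by move=> x; rewrite /hole_at; lia.
    by apply: eq_map => x; rewrite val_put /hole_at (negbTE kr).
  rewrite [X in knuth _ X _](_ : _ =
    [seq val_at F r.+1 x | x <- iota (lo r.+1) (hi r.+1 - lo r.+1)] ++
    row_word F lo hi (hole_at r c) r); last first.
    by rewrite [row_word _ _ _ _ r.+1]row_word_plain // => x; rewrite /hole_at; lia.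
  rewrite [X in knuth _ _ X](_ : _ = row_word F lo hi (hole_at r.+1 c) r.+1 ++
    [seq val_at (put F r c (Some b)) r x | x <- iota (lo r) (hi r - lo r)]); last first.
    rewrite [row_word _ _ _ _ r]row_word_plain; last by move=> x; rewrite /hole_at; lia.
    by congr (_ ++ _); apply: eq_map => x; rewrite val_put /hole_at ifF //; lia.
  rewrite !row_word_hole //; last by lia.
  rewrite (@iota_split (lo r) (hi r - lo r) c); last by lia.
  have -> : lo r + (hi r - lo r) - c = (hi r - c.+1).+1 by lia.
  rewrite (@iota_split (lo r.+1) (hi r.+1 - lo r.+1) c); last by lia.
  have -> : lo r.+1 + (hi r.+1 - lo r.+1) - c = (hi r.+1 - c.+1).+1 by lia.
  have L := lo1 r.
  rewrite (@iota_split (lo r.+1) (c - lo r.+1) (lo r)); last by lia.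
  have -> : lo r.+1 + (c - lo r.+1) - lo r = c - lo r by lia.
  rewrite !map_cat /= vb val_put /hole_at !eqxx /= -!catA.
  have put_row s m : c \notin iota s m ->
      [seq val_at (put F r c (Some b)) r x | x <- iota s m] = [seq val_at F r x | x <- iota s m].
    move=> cs; apply/eq_in_map => x xs; rewrite val_put /hole_at eqxx /=.
    by case: eqP => // xc; rewrite -xc xs in cs.
  rewrite !put_row ?mem_iota; try by lia.
  apply: knuth_catl; rewrite catA [X in knuth _ _ X]catA.
  apply: knuth_slide_down.
  + rewrite all2E !size_map eqxx /= zip_map all_map; apply/allP => x.
    by rewrite mem_iota /= => ?; apply: cols; rewrite // /hole_at; lia.
  + rewrite -[b]vb -(map_cons (val_at F r.+1)) -map_cat.
    have -> : iota (lo r) (c - lo r) ++ c :: iota c.+1 (hi r.+1 - c.+1) =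
       iota (lo r) (hi r.+1 - lo r).
      rewrite (@iota_split (lo r) (hi r.+1 - lo r) c); last by lia.
      by have -> : lo r + (hi r.+1 - lo r) - c = (hi r.+1 - c.+1).+1 by lia.
    by apply: sorted_map_iota => x y ? ? ?; apply: rows; rewrite /hole_at; lia.
  + rewrite (path_sortedE leq_trans) all_map; apply/andP; split.
      by apply/allP => x; rewrite mem_iota /= => ?; apply: right; lia.
    by apply: sorted_map_iota => x y ? ? ?; apply: rows; rewrite /hole_at; lia.
  apply: dominates_map_iota; first by have := hi1 r; lia.
  by move=> x ?; apply: cols; rewrite // /hole_at; lia.
have L := lo1 r; have H := hi1 r.
split=> //.
- move=> k x Hk; rewrite val_put; case: (boolP (hole_at r c k x)) => H1; last first.
    have -> : put F r c (Some b) k x = F k x by rewrite /put -/(hole_at r c k x) (negbTE H1).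
    exact: cell.
  by have /andP[/eqP Ek /eqP Ex] := H1; rewrite /put -/(hole_at r c k x) H1 Ek Ex ifT //; lia.
- move=> k x kx Hk; rewrite val_put; case: ifP => H1; last by apply: lett => //; rewrite H1.
  by rewrite -vb; apply: lett.
- move=> k x x' lx xx' x'h Hk H'; rewrite !val_put; case: ifP => H1; case: ifP => H2 //.
  + move: H1 H2; rewrite /hole_at => H1 H2.
    have E : k = r by lia.
    by rewrite E in x'h H2 *; apply: right; lia.
  + move: H1 H2; rewrite /hole_at => H1 H2.
    have E : k = r by lia.
    by rewrite E in lx H1 *; apply: left; lia.
  by apply: rows => //; rewrite ?H1 ?H2.
move=> k k' x kk' lx xh Hk H'; rewrite !val_put; case: ifP => H1; case: ifP => H2 //.
- by move: H1 H2; rewrite /hole_at; lia.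
- move: H1 H2 H'; rewrite /hole_at => H1 H2 H'; have -> : x = c by lia.
  by rewrite -vb; apply: cols; rewrite // /hole_at; lia.
- move: H1 H2 Hk; rewrite /hole_at => H1 H2 Hk; have E : x = c by lia.
  by rewrite E in lx *; rewrite -vb; apply: cols; rewrite // /hole_at; lia.
by apply: (@cols k k') => //; rewrite ?H1 ?H2.
Qed.

Definition remove_cell (f : nat -> nat) (r : nat) : nat -> nat := fun k => f k - (k == r).

Lemma val_put_None F r c r' c' : ~~ hole_at r c r' c' ->
  val_at (put F r c None) r' c' = val_at F r' c'.
Proof. by rewrite /val_at /put /hole_at => /negbTE ->. Qed.

Lemma remove_cell_homo f r : (forall k, f k.+1 <= f k) -> f r.+1 < f r ->
  forall k, remove_cell f r k.+1 <= remove_cell f r k.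
Proof.
move=> fh fr k; rewrite /remove_cell; have := fh k.
by case: (eqVneq k r) => [->|]; case: (eqVneq k.+1 r) => // *; lia.
Qed.

Lemma skew_stop n R lo hi r c F : skew_filling n R lo hi (hole_at r c) F -> lo r <= c < hi r ->
  F r c.+1 = None -> F r.+1 c = None ->
  skew_filling n R lo (remove_cell hi r) no_hole (put F r c None) /\
  reading (row_word F lo hi (hole_at r c)) R =
  reading (row_word (put F r c None) lo (remove_cell hi r) no_hole) R.
Proof.
move=> S /andP[lc ch] F1 F2; have [lo1 hi1 lh hR cell lett rows cols] := S.
have h1 : ~~ hole_at r c r c.+1 by rewrite /hole_at; lia.
have h2 : ~~ hole_at r c r.+1 c by rewrite /hole_at; lia.
have c1 : hi r = c.+1 by have := cell r c.+1 h1; rewrite F1; case: ifP => //; lia.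
have c2 : hi r.+1 <= c by have := cell r.+1 c h2; rewrite F2; case: ifP => //; have := lo1 r; lia.
have cellE k x : (lo k <= x < remove_cell hi r k) = (lo k <= x < hi k) && ~~ hole_at r c k x.
  rewrite /remove_cell /hole_at; case: (eqVneq k r) => [->|_] /=; last by rewrite subn0 andbT.
  by rewrite c1; lia.
split; last first.
  apply: eq_reading => k _; rewrite [RHS]row_word_plain //.
  have [->|kr] := eqVneq k r.
    rewrite row_word_hole ?lc // c1 subnn cats0 /remove_cell eqxx c1 subn1 /=.
    by apply/eq_in_map => x; rewrite mem_iota => ?; rewrite val_put_None // /hole_at; lia.
  have H x : ~~ hole_at r c k x by rewrite /hole_at (negbTE kr).
  rewrite row_word_plain // /remove_cell (negbTE kr) subn0.
  by apply: eq_map => x; rewrite val_put_None.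
split=> //.
- by apply: remove_cell_homo => //; lia.
- move=> k; rewrite /remove_cell; have := lh k.
  by case: (eqVneq k r) => [->|] *; rewrite ?subn0 //; lia.
- by rewrite /remove_cell hR.
- move=> k x _; rewrite cellE; have [H|H] := boolP (hole_at r c k x).
    by rewrite andbF /put -/(hole_at r c k x) H.
  by rewrite andbT val_put_None // /put -/(hole_at r c k x) (negbTE H); apply: cell.
- by move=> k x; rewrite cellE => /andP[A B] _; rewrite val_put_None //; apply: lett.
- move=> k x x' lx xx' x'h _ _.
  have := cellE k x; have := cellE k x'.
  have -> : lo k <= x < remove_cell hi r k by lia.
  have -> : lo k <= x' < remove_cell hi r k by lia.
  move=> /esym/andP[/andP[_ B1] A1] /esym/andP[_ A2].
  by rewrite !val_put_None //; apply: rows.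
move=> k k' x kk' lx xh _ _.
have := cellE k x; have := cellE k' x.
have H1 := le_homo lo1 (ltnW kk').
have H2 := le_homo (remove_cell_homo hi1 (leq_ltn_trans c2 ch)) (ltnW kk').
have -> : lo k <= x < remove_cell hi r k by lia.
have -> : lo k' <= x < remove_cell hi r k' by lia.
move=> /esym/andP[/andP[_ B1] A1] /esym/andP[_ A2].
by rewrite !val_put_None //; apply: cols.
Qed.

Lemma slide_skew n R lo hi r c F G : slide F r c G ->
  skew_filling n R lo hi (hole_at r c) F -> lo r <= c < hi r ->
  exists hi', skew_filling n R lo hi' no_hole G /\
    knuth n (reading (row_word F lo hi (hole_at r c)) R)
            (reading (row_word G lo hi' no_hole) R).
Proof.
elim=> {F r c G} [F r c G F1 F2 ->|F r c G a Fa Fb _ IH|F r c G b Fb Fa _ IH] S lch.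
- have [S' E] := skew_stop S lch F1 F2; exists (remove_cell hi r); split=> //.
  by rewrite E; apply: Knuth_refl.
- have [c1 S' ->] := skew_put_right S lch Fa Fb.
  by apply: IH => //; move: lch; lia.
have [lch' S' K] := skew_put_down S lch Fb Fa.
have [hi' [S2 K2]] := IH S' lch'; exists hi'; split=> //; exact: Knuth_trans K K2.
Qed.

Lemma slide_exists n R lo hi r c F :
  skew_filling n R lo hi (hole_at r c) F -> lo r <= c < hi r -> exists G, slide F r c G.
Proof.
have [m] := ubnP (hi 0 + R - (r + c)); elim: m r c F => // m IH r c F mE S lch.
have hr : hi r <= hi 0 := le_homo (skew_hi S) (leq0n r).
have rR : r < R by rewrite ltnNge; apply/negP => /(skew_bound_le S); lia.
have right a : F r c.+1 = Some a -> (forall b, F r.+1 c = Some b -> a < b) ->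
    exists G, slide F r c G.
  move=> Fa Fb; have [c1 S' _] := skew_put_right S lch Fa Fb.
  have [||G sl] := IH r c.+1 _ _ S'; [lia|lia|].
  by exists G; apply: Slide_right sl.
have down b : F r.+1 c = Some b -> (forall a, F r c.+1 = Some a -> b <= a) ->
    exists G, slide F r c G.
  move=> Fb Fa; have [lch' S' _] := skew_put_down S lch Fb Fa.
  have [||G sl] := IH r.+1 c _ _ S'; [lia|lia|].
  by exists G; apply: Slide_down sl.
case Fa: (F r c.+1) => [a|]; case Fb: (F r.+1 c) => [b|].
- case: (ltnP a b) => ab; first by apply: (right a) => // b'; rewrite Fb => -[<-].
  by apply: (down b) => // a'; rewrite Fa => -[<-].
- by apply: (right a) => // b'; rewrite Fb.
- by apply: (down b) => // a'; rewrite Fa.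
by exists (put F r c None); apply: Slide_stop.
Qed.

Lemma skew_open_hole n R lo hi F r : skew_filling n R lo hi no_hole F -> lo r.+1 < lo r ->
  [/\ skew_filling n R (remove_cell lo r) hi (hole_at r (lo r).-1) F,
      remove_cell lo r r <= (lo r).-1 < hi r &
      reading (row_word F lo hi no_hole) R =
      reading (row_word F (remove_cell lo r) hi (hole_at r (lo r).-1)) R].
Proof.
move=> S lr; have [lo1 hi1 lh hR cell lett rows cols] := S.
have cellE k x : ~~ hole_at r (lo r).-1 k x -> (remove_cell lo r k <= x) = (lo k <= x).
  rewrite /remove_cell /hole_at; case: (eqVneq k r) => [->|_] /=; last by rewrite subn0.
  by lia.
have lhr := lh r.
have E : remove_cell lo r r = (lo r).-1 by rewrite /remove_cell eqxx subn1.
split; last first.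
- apply: eq_reading => k _; rewrite [LHS]row_word_plain //.
  have [->|kr] := eqVneq k r.
    rewrite row_word_hole E ?subnn /=; last by lia.
    by have -> : (lo r).-1.+1 = lo r by lia.
  have H x : ~~ hole_at r (lo r).-1 k x by rewrite /hole_at (negbTE kr).
  by rewrite row_word_plain // /remove_cell (negbTE kr) subn0.
- by rewrite E; lia.
split=> //.
- exact: remove_cell_homo.
- by move=> k; apply: leq_trans (leq_subr _ _) (lh k).
- by move=> k x H; rewrite cellE //; apply: cell.
- by move=> k x; move=> + H; rewrite cellE // => ?; apply: lett.
- by move=> k x x' + xx' xh H H'; rewrite cellE // => ?; apply: rows.
by move=> k k' x kk' + xh H H'; rewrite cellE // => ?; apply: cols.
Qed.

Lemma rectifies_skew n R hi X H : rectifies X H ->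
  skew_filling n R (inner X) hi no_hole (entries X) ->
  exists lo' hi', [/\ forall r, lo' r = 0, skew_filling n R lo' hi' no_hole H &
    knuth n (reading (row_word (entries X) (inner X) hi no_hole) R)
            (reading (row_word H lo' hi' no_hole) R)].
Proof.
move=> rX; elim: rX hi => {X H} [X H X0 ->|X H r G lr sl _ IH] hi S.
  by exists (inner X), hi; split=> //; apply: Knuth_refl.
have [S' lch ->] := skew_open_hole S lr.
have [hi1 [S1 K1]] := slide_skew sl S' lch.
have [lo' [hi' [L S2 K2]]] := IH _ S1.
by exists lo', hi'; split=> //; apply: Knuth_trans K1 K2.
Qed.

Lemma rectifies_exists n R lo hi F : skew_filling n R lo hi no_hole F ->
  exists H, rectifies (SkewTableau lo F) H.
Proof.
have [m] := ubnP (\sum_(r < R) lo r); elim: m lo hi F => // m IH lo hi F mE S.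
have [/existsP[r lr]|/existsPn H] := boolP [exists r : 'I_R, lo r.+1 < lo r].
  have [S' lch _] := skew_open_hole S lr; have [G sl] := slide_exists S' lch.
  have [hi' [S2 _]] := slide_skew sl S' lch.
  have [|H rH] := IH _ _ _ _ S2; last by exists H; exact: (@Rect_slide (SkewTableau lo F) H r G).
  rewrite -ltnS; apply: leq_trans mE; rewrite ltnS.
  rewrite (bigD1 r) //= [X in _ < X](bigD1 r) //= -addSn leq_add //.
    by rewrite /remove_cell eqxx; lia.
  by apply: leq_sum => k _; apply: leq_subr.
exists F; apply: Rect_straight => // r /=.
have L k : k <= R -> lo (R - k) = 0.
  elim: k => [|k IHk] kR; first by have := skew_lo_hi S R; rewrite (skew_bound S) subn0; lia.
  have kR' : R - k.+1 < R by lia.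
  have := H (Ordinal kR'); rewrite /= -leqNgt.
  have -> : (R - k.+1).+1 = R - k by lia.
  by rewrite IHk; lia.
case: (leqP r R) => rR; first by have := L _ (leq_subr r R); rewrite subKn.
by have := skew_lo_hi S r; rewrite (skew_bound_le S (ltnW rR)); lia.
Qed.

Section Straight.

Variables (n R : nat) (lo hi : nat -> nat) (H : filling).
Hypothesis lo0 : forall r, lo r = 0.
Hypothesis S : skew_filling n R lo hi no_hole H.

Lemma straight_row r : row_word H lo hi no_hole r = mkseq (val_at H r) (hi r).
Proof. by rewrite row_word_plain // lo0 subn0. Qed.

Lemma straight_cell r c : H r c = onth (mkseq (val_at H r) (hi r)) c.
Proof.
rewrite (skew_cell S) // lo0 /=; case: ifP => ch.
  by rewrite onthE (nth_map 0) ?size_mkseq // nth_mkseq.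
by rewrite onth_default // size_mkseq leqNgt ch.
Qed.

Lemma straight_sorted r : sorted leq (mkseq (val_at H r) (hi r)).
Proof.
by apply: sorted_map_iota => x y _ xy yh; apply: (skew_row S) => //; rewrite lo0.
Qed.

Lemma straight_letters r a : a \in mkseq (val_at H r) (hi r) -> 1 <= a <= n.
Proof.
by move=> /mapP[c]; rewrite mem_iota => /= ch ->; apply: (skew_letter S); rewrite ?lo0.
Qed.

Lemma straight_col r c : c < hi r.+1 -> val_at H r c < val_at H r.+1 c.
Proof. by move=> ch; apply: (skew_col S) => //; rewrite lo0. Qed.

Lemma straight_act j :
  eq_upto n (act n (fun _ _ => 0) (reading (row_word H lo hi no_hole) R) j)
            (cum (mkseq (val_at H j) (hi j))).
Proof.
rewrite (eq_reading (g := fun r => mkseq (val_at H r) (hi r))); last by move=> r _; apply: straight_row.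
apply: (@act_reading n (fun r => mkseq (val_at H r) (hi r))).
- exact: straight_sorted.
- by move=> r; apply: cum_eq0; apply/allP => a /straight_letters /andP[].
- move=> r i i0; rewrite /mkseq -(subnKC (skew_hi S r)) iotaD map_cat /cum count_cat !count_map.
  apply: leq_trans (leq_addr _ _).
  have : {in iota 0 (hi r.+1), forall c, val_at H r.+1 c <= i -> val_at H r c <= i.-1}.
    by move=> c; rewrite mem_iota => ch; have := straight_col ch; lia.
  elim: (iota _ _) => //= c s IH sub; apply: leq_add.
    by have := sub c (mem_head _ _); case: leqP => //= _ ->.
  by apply: IH => x xs; apply: sub; rewrite inE xs orbT.
by move=> r Rr; rewrite (skew_bound_le S Rr).
Qed.

Lemma straight_hi r : n <= r -> hi r = 0.
Proof.
move=> nr; apply/eqP; rewrite -leqn0 leqNgt; apply/negP => h.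
have : r < val_at H r 0.
  elim: (r) h => [|k IH] kh.
    by have /andP[] : 0 < val_at H 0 0 <= n by apply: (skew_letter S); rewrite ?lo0.
  by apply: leq_ltn_trans (IH (leq_trans kh (skew_hi S k))) (straight_col kh).
have : 0 < val_at H r 0 <= n by apply: (skew_letter S); rewrite ?lo0.
lia.
Qed.

End Straight.

Lemma eq_cum n s t : row_sorted n s -> row_sorted n t -> eq_upto n (cum s) (cum t) -> s = t.
Proof.
move=> /andP[ss sn] /andP[st tn] E.
apply: (sorted_eq leq_trans anti_leq ss st); apply/allP => x _ /=.
have big u y : all (fun a => a <= n) u -> n <= y -> cum u y = size u.
  by move=> un ny; apply/eqP; rewrite -all_count; apply: sub_all un => a /leq_trans; apply.
have Ey y : cum s y = cum t y.
  case: (leqP y n) => yn; first exact: E.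
  by rewrite !big ?(ltnW yn) // -(cum_size sn) -(cum_size tn) E.
have C u : count_mem x u + (if x is x'.+1 then cum u x' else 0) = cum u x.
  case: x => [|x]; first by rewrite addn0; apply: eq_count => a /=; lia.
  elim: u => // a u IH; rewrite !cum_cons -IH /=.
  by move: (count_mem _ _) (cum _ _) => p q; lia.
have := C s; rewrite Ey -(C t) => /eqP.
have -> : (if x is x'.+1 then cum s x' else 0) = if x is x'.+1 then cum t x' else 0.
  by case: (x).
by rewrite eqn_add2r.
Qed.

(** * Rectification of the star product *)

Lemma tableau_size n T r : is_tableau n T ->
  size (nth [::] T r.+1) <= size (nth [::] T r).
Proof.
move=> [_ _ Tc]; rewrite leqNgt; apply/negP => H.
by have [] := Tc r _ H; rewrite ltnn.
Qed.

Lemma tableau_col n T r r' c : is_tableau n T -> r < r' -> c < size (nth [::] T r') ->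
  nth 0 (nth [::] T r) c < nth 0 (nth [::] T r') c.
Proof.
move=> hT; have [_ _ Tc] := hT; elim: r' => // k IH; rewrite ltnS leq_eqVlt => /orP[/eqP <-|rk] ck.
  by have [] := Tc r c ck.
have [ck' H] := Tc k c ck; exact: ltn_trans (IH rk ck') H.
Qed.

Lemma tableau_row_nth n T r c c' : is_tableau n T -> c <= c' -> c' < size (nth [::] T r) ->
  nth 0 (nth [::] T r) c <= nth 0 (nth [::] T r) c'.
Proof.
move=> hT cc ch; have /andP[ss _] := nth_row_sorted r (tableau_row_sorted hT).
by apply: (sorted_leq_nth leq_trans leqnn) => //; rewrite inE; apply: leq_ltn_trans ch.
Qed.

Lemma tableau_letter n T r c : is_tableau n T -> c < size (nth [::] T r) ->
  1 <= nth 0 (nth [::] T r) c <= n.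
Proof.
move=> hT ch; have /andP[_ sn] := nth_row_sorted r (tableau_row_sorted hT).
rewrite (leq_ltn_trans (leq0n r) (tableau_entry_gt hT ch)) /=.
by apply: (allP sn); apply: mem_nth.
Qed.

Lemma tableau_nth_default n T r : is_tableau n T -> n <= r -> nth [::] T r = [::].
Proof. by move=> [sT _ _] nr; rewrite nth_default // sT. Qed.

Lemma tableau_act n T : is_tableau n T ->
  forall j, eq_upto n (act n (fun _ _ => 0) (reading (nth [::] T) n) j) (counts T j).
Proof.
move=> hT; apply: act_reading.
- by move=> r; have /andP[] := nth_row_sorted r (tableau_row_sorted hT).
- by move=> r; apply: (tableau_counts_eq0 hT).
- move=> r i i0; have H := @tableau_size n T r hT.
  set s := nth [::] T r.+1; set t := nth [::] T r.
  have C : forall c, c < size s -> nth 0 t c < nth 0 s c.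
    by move=> c cs; apply: (tableau_col hT).
  move: H C; rewrite -/s -/t; elim: s t => [|a s IH] [|b t] //= st C.
  rewrite !cum_cons; apply: leq_add; first by have := C 0 isT; rewrite /=; lia.
  by apply: IH => // c cs; apply: (C c.+1).
by move=> r nr; apply: tableau_nth_default hT nr.
Qed.

Section Star.

Variables (n : nat) (T U : seq (seq nat)).
Hypotheses (hT : is_tableau n T) (hU : is_tableau n U).

Let l1 := size (nth [::] T 0).
Let hi r := if r < n then l1 + size (nth [::] U r) else size (nth [::] T (r - n)).

Lemma onth_nthE (s : seq nat) c : onth s c = if c < size s then Some (nth 0 s c) else None.
Proof. by case: ltnP => H; [rewrite onthE (nth_map 0) | rewrite onth_default]. Qed.

Lemma star_val r c :
  val_at (entries (star n T U)) r c =
  if r < n then (if c < l1 then 0 else nth 0 (nth [::] U r) (c - l1))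
  else nth 0 (nth [::] T (r - n)) c.
Proof.
rewrite /val_at /entries /star /fill -/l1; case: (ltnP r n) => rn; last by rewrite odflt_onth.
by case: (ltnP c l1) => // cl; rewrite odflt_onth.
Qed.

Lemma star_skew : skew_filling n (n + n) (inner (star n T U)) hi no_hole (entries (star n T U)).
Proof.
have szT r : size (nth [::] T r) <= l1.
  exact: (le_homo (f := fun r => size (nth [::] T r)) (fun k => tableau_size k hT) (leq0n r)).
have loE r : inner (star n T U) r = if r < n then l1 else 0 by [].
have hi1 r : hi r.+1 <= hi r.
  rewrite /hi; case: (ltnP r.+1 n) => rn.
    by rewrite (ltnW rn) leq_add2l; apply: tableau_size hU.
  case: (ltnP r n) => rn'; first by apply: leq_trans (szT _) (leq_addr _ _).
  by rewrite subSn //; apply: tableau_size hT.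
split=> //.
- by move=> r; rewrite !loE; case: (ltnP r.+1 n) => // rn; rewrite (ltnW rn).
- by move=> r; rewrite loE /hi; case: ifP => // _; apply: leq_addr.
- by rewrite /hi ltnNge leq_addr /= addKn (tableau_nth_default hT).
- move=> r c _; rewrite loE; case: ifP => [/andP[lc ch]|H].
    rewrite star_val //= /fill -/l1; move: lc ch; rewrite /hi; case: (ltnP r n) => rn lc ch.
      by rewrite ltnNge lc /= onth_nthE ifT //; lia.
    by rewrite onth_nthE ch.
  rewrite /= /fill -/l1; move: H; rewrite /hi; case: (ltnP r n) => rn H.
    by case: ltnP => // lc; rewrite onth_nthE ifF //; lia.
  by rewrite onth_nthE; move: H => /= ->.
- move=> r c + _; rewrite loE => /andP[lc ch]; rewrite star_val //.
  move: lc ch; rewrite /hi; case: (ltnP r n) => rn lc ch.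
    by rewrite (ltnNge c) lc /=; apply: (tableau_letter hU); lia.
  exact: (tableau_letter hT).
- move=> r c c' + cc ch _ _; rewrite loE => lc.
  rewrite !star_val.
  move: lc ch; rewrite /hi; case: (ltnP r n) => rn lc ch.
    rewrite (ltnNge c) (ltnNge c') (leq_trans lc cc) lc /=; apply: (tableau_row_nth hU); lia.
  exact: (tableau_row_nth hT).
move=> r r' c rr + ch _ _; rewrite loE => lc.
rewrite !star_val.
move: lc ch; rewrite /hi; case: (ltnP r n) => rn; case: (ltnP r' n) => rn' lc ch.
- by rewrite (ltnNge c) lc /=; apply: (tableau_col hU); lia.
- by have := szT (r' - n); lia.
- lia.
by apply: (tableau_col hT) => //; lia.
Qed.

Lemma map_nth_iota0 (s : seq nat) : [seq nth 0 s c | c <- iota 0 (size s)] = s.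
Proof. exact: mkseq_nth. Qed.

Lemma star_reading :
  reading (row_word (entries (star n T U)) (inner (star n T U)) hi no_hole) (n + n) =
  reading (nth [::] T) n ++ reading (nth [::] U) n.
Proof.
have loE r : inner (star n T U) r = if r < n then l1 else 0 by [].
rewrite reading_add; congr (_ ++ _); apply: eq_reading => r rn; rewrite row_word_plain // loE.
  have nr : n + r < n = false by lia.
  rewrite {1}/hi nr subn0 -[RHS]map_nth_iota0 addKn; apply/eq_in_map => c _.
  by rewrite star_val nr addKn.
rewrite {1}/hi rn addKn -[RHS]map_nth_iota0 -[X in iota X _]addn0 iotaDl -map_comp.
apply/eq_in_map => c _ /=.
by rewrite star_val rn ltnNge leq_addr /= addKn.
Qed.

Lemma insertion_stage0 :
  insertion_stage T U 0 = foldl row_insert T (reading (nth [::] U) n).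
Proof.
have [<- _ _] := hU; rewrite reading_nth /insertion_stage drop0.
by elim: (rev U) (T) => //= s ss IH J; rewrite foldl_cat.
Qed.

Lemma star_act j :
  eq_upto n (act n (fun _ _ => 0)
    (reading (row_word (entries (star n T U)) (inner (star n T U)) hi no_hole) (n + n)) j)
    (counts (insertion_stage T U 0) j).
Proof.
move=> i ni; rewrite star_reading act_cat insertion_stage0.
have wU m : all (fun a => a <= n) (reading (nth [::] U) m).
  elim: m => //= k IH; rewrite all_cat IH andbT.
  by have /andP[] := nth_row_sorted k (tableau_row_sorted hU).
have [_ ->] := counts_insert_word (tableau_row_sorted hT) (wU n); rewrite //.
exact: (eq_upto_act _ (tableau_act hT)).
Qed.

Lemma rectification_rows H : rectifies (star n T U) H ->
  exists lo' hi', [/\ forall r, lo' r = 0,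
    skew_filling n (n + n) lo' hi' no_hole H &
    forall j, eq_upto n (cum (mkseq (val_at H j) (hi' j))) (counts (insertion_stage T U 0) j)].
Proof.
move=> rH; have [lo' [hi' [L S K]]] := rectifies_skew rH star_skew.
exists lo', hi'; split=> // j i ni.
by rewrite -(star_act j ni) (knuth_act K) // (straight_act L S).
Qed.

End Star.

Theorem theorem7p9 (n : nat) (lambda mu nu delta rho : n.-tuple nat)
    (hlambda : is_partition lambda) (hmu : is_partition mu)
    (hnu : is_partition nu) (hdelta : is_partition delta)
    (hrho : is_partition rho)
    (M N : nat -> nat -> nat -> int)
    (hM : HIVE lambda delta rho M) (hN : HIVE mu nu delta N)
    (hMN : matching n M N)
    (TM TN : seq (seq nat))
    (hTM : tableau_of n (hat n M) TM) (hTN : tableau_of n (hat n N) TN) :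
  eq_pattern n (recording TM TN) (hat n (octa_P n M N)) /\
  exists TQ : seq (seq nat),
    tableau_of n (hat n (octa_Q n M N)) TQ /\
    rectification_is (star n TM TN) TQ.
Proof.
split; first exact: recording_hat.
have [tM tN] := (proj1 hTM, proj1 hTN).
have [H rH] := rectifies_exists (star_skew tM tN).
have [lo [hi [L S V]]] := rectification_rows tM tN rH.
pose TQ := mkseq (fun r => mkseq (val_at H r) (hi r)) n.
have nthTQ r : nth [::] TQ r = mkseq (val_at H r) (hi r).
  case: (ltnP r n) => rn; first by rewrite nth_mkseq.
  by rewrite nth_default ?size_mkseq // (straight_hi L S rn).
have sorted_rows lo' hi' H' r : (forall r, lo' r = 0) ->
    skew_filling n (n + n) lo' hi' no_hole H' -> row_sorted n (mkseq (val_at H' r) (hi' r)).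
  move=> L' S'; rewrite /row_sorted (straight_sorted L' S').
  by apply/allP => a /(straight_letters L' S') /andP[].
exists TQ; split; first split.
- split; first by rewrite size_mkseq.
    move=> s /mapP[r _ ->]; split; first exact: straight_sorted L S r.
    by move=> a; apply: straight_letters L S r a.
  move=> r c; rewrite !nthTQ !size_mkseq => cr.
  have cr' := leq_trans cr (skew_hi S r).
  by rewrite !nth_mkseq //; split=> //; apply: straight_col L S r c cr.
- move=> i j ij ni; rewrite /pattern nthTQ -/(cum _ _) V //.
  by rewrite (hat_octa_Q hMN hTM hTN ij ni).
split; first by exists H.
move=> H' rH' r c; have [lo' [hi' [L' S' V']]] := rectification_rows tM tN rH'.
rewrite (straight_cell L' S') /fill nthTQ; congr onth.
apply: (@eq_cum n); [exact: sorted_rows L' S' | exact: sorted_rows L S|].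
by move=> i ni; rewrite V' // V.
Qed.
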